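(* Let $M$ be a matroid and let $e=\sum_{K\in\mathcal F}(K)\in S(M)$ be the sum of the idempotents corresponding to cyclic flats. The matroidal Schur algebra $\check R(M)$ is isomorphic to $$\check R(M)\cong eS(M)e/(\bigvee),$$ where $(\bigvee)$ is the following relation: if $K$ is a flat with a coloop $j\in K$ and $L\lessdot K$ is the flat $K\setminus\{j\}$ obtained by removing $j$, then $$(K\gtrdot L\lessdot K)=(K).$$ Here $eS(M)e/(\bigvee)$ means $eS(M)e/eIe$, where $I$ is the two-sided ideal of $S(M)$ generated by all the elements $(K\gtrdot L\lessdot K)-(K)$, where $K$ ranges over all flats of $M$ having a coloop, $j$ ranges over all coloops of $K$, and $L=K\setminus\{j\}$.
   Context: $M$ is a matroid on a finite ground set $E$ with lattice of flats $\mathcal L$ ordered by inclusion and rank function $\rho$. For flats write $K\lessdot L$ (or $L\gtrdot K$) if $L$ covers $K$. A flag path is a finite nonempty sequence $(K_1,\dots,K_l)$ of flats with $K_i\lessdot K_{i+1}$ or $K_i\gtrdot K_{i+1}$ for each $i<l$. The free $\mathbb Z$-module on flag paths is an algebra under concatenation: $(K_1,\dots,K_l)\cdot(L_1,\dots,L_{l'})=(K_1,\dots,K_l=L_1,L_2,\dots,L_{l'})$ if $K_l=L_1$ and $0$ otherwise. $S(M)$ is its quotient by the two-sided ideal generated by: (FS) for flats $L<K$ with $\rho(K)=\rho(L)+2$: $\sum_X(L\lessdot X\lessdot K)=0=\sum_X(K\gtrdot X\gtrdot L)$, sums over flats $X$ with $K\gtrdot X\gtrdot L$; ($\bigwedge$)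 for $K\lessdot L$ and $K'\lessdot L$: $(K\lessdot L\gtrdot K')$ equals $|L\setminus K|\,(K)$ if $K=K'$; $-(K\gtrdot K\cap K'\lessdot K')$ if $K\ne K'$ and $K\cap K'\lessdot K$; and $0$ otherwise. A coloop of a flat $K$ is a coloop of the restriction $M^K$, i.e. an element $j\in K$ such that $K\setminus\{j\}$ is a flat. A flat is cyclic if it has no coloops; $\mathcal F$ is the set of cyclic flats. Definition of $\check R(M)$. Fix a total order on $E$. In the exterior algebra over $\mathbb Z$ on generators $E$, for $S=\{s_1<\dots<s_p\}\subseteq E$ put $e_S=s_1\wedge\dots\wedge s_p$. For flats $F\subseteq G$, $M^G_F$ is the restriction of $M$ to $G$ contracted by $F$ (a matroid on $G\setminus F$ whose bases are the $B\subseteq G\setminus F$ with $|B|=\rho(G)-\rho(F)$ and $G$ the closure of $F\cup B$); $\mathcal B^G_F$ is the free $\mathbb Z$-module spanned by $e_B$ for bases $B$ of $M^G_F$, and $\mathcal B^G_F=0$ if $F\not\subseteq G$. $\mathcal B=\bigoplus_{F,G\in\mathcal F}\mathcal B^G_F$ (sum over cyclic flats), with the symmetric form for which the summands are orthogonal and the monomials $e_B$ in each summand orthonormal. The wedge product gives $\ast:\mathcal B^H_G\otimes\mathcal B^G_F\to\mathcal B^H_F$, extended by $\mathcal B^H_G\ast\mathcal B^{G'}_F=0$ for $G\ne G'$. For $b\in\mathcal B$, $\mu_b\in\mathrm{End}(\mathcal B)$ is $\mu_b(x)=b\ast x$ and $\kappa_b$ is its adjoint. For $F\subseteq G$, $\check{\mathcal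 U}^G_F=\{x\in\mathcal B^G_F:(\sum_{s\in G\setminus F}s)\wedge x=0\}$ and $\check{\mathcal U}=\bigoplus_{F\subseteq G,\,F,G\in\mathcal F}\check{\mathcal U}^G_F$. $\check R(M)$ is the subalgebra of $\mathrm{End}(\mathcal B)$ generated by $\mu_{\check u}$ and $\kappa_{\check u}$ for all $\check u\in\check{\mathcal U}$. *)

(* Defs.v *)
From HB Require Import structures.
From mathcomp Require Import all_boot all_order all_algebra finmap.
From mathcomp.multinomials Require Import monalg.
From mathcomp.classical Require Import boolp.

Set Implicit Arguments.
Unset Strict Implicit.
Unset Printing Implicit Defensive.

Import GRing.Theory.

Local Open Scope ring_scope.
Local Open Scope quotient_scope.

Record ideal (A : pzRingType) := Ideal {
  ideal_mem :> A -> Prop;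
  ideal_mem0 : ideal_mem 0;
  ideal_memD : forall x y, ideal_mem x -> ideal_mem y -> ideal_mem (x + y);
  ideal_memMl : forall a x, ideal_mem x -> ideal_mem (a * x);
  ideal_memMr : forall x a, ideal_mem x -> ideal_mem (x * a) }.

Inductive gen_mem (A : pzRingType) (X : A -> Prop) : A -> Prop :=
| Gen_in x : X x -> gen_mem X x
| Gen_0 : gen_mem X 0
| Gen_D x y : gen_mem X x -> gen_mem X y -> gen_mem X (x + y)
| Gen_Ml a x : gen_mem X x -> gen_mem X (a * x)
| Gen_Mr x a : gen_mem X x -> gen_mem X (x * a).

Definition ideal_gen (A : pzRingType) (X : A -> Prop) : ideal A :=
  Ideal (@Gen_0 A X) (@Gen_D A X) (@Gen_Ml A X) (@Gen_Mr A X).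

Section Quotient.
Variables (A : pzRingType) (I : ideal A).

Lemma ideal_memN x : I x -> I (- x).
Proof. by move=> Ix; rewrite -mulN1r; apply: ideal_memMl. Qed.

Lemma ideal_memB x y : I x -> I y -> I (x - y).
Proof. by move=> Ix Iy; apply: ideal_memD => //; apply: ideal_memN. Qed.

Definition ideal_equiv (x y : A) : bool := `[< I (x - y) >].

Lemma ideal_equiv_refl : reflexive ideal_equiv.
Proof. by move=> x; apply/asboolP; rewrite subrr; apply: ideal_mem0. Qed.

Lemma ideal_equiv_sym : symmetric ideal_equiv.
Proof.
by move=> x y; apply/asboolP/asboolP => /ideal_memN; rewrite opprB.
Qed.

Lemma ideal_equiv_trans : transitive ideal_equiv.
Proof.
move=> y x z /asboolP Ixy /asboolP Iyz; apply/asboolP.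
by rewrite -(subrKA y); apply: ideal_memD.
Qed.

Canonical ideal_equiv_rel :=
  EquivRel ideal_equiv ideal_equiv_refl ideal_equiv_sym ideal_equiv_trans.

Definition quot := {eq_quot ideal_equiv}.

HB.instance Definition _ := Choice.on quot.

Definition quot_pi (x : A) : quot := \pi_{eq_quot ideal_equiv} x.
Local Notation rep := (fun x : quot => repr (x : {eq_quot ideal_equiv})).

Definition quot_add (x y : quot) : quot := quot_pi (rep x + rep y).
Definition quot_opp (x : quot) : quot := quot_pi (- rep x).
Definition quot_mul (x y : quot) : quot := quot_pi (rep x * rep y).

Lemma quot_piP x y : quot_pi x = quot_pi y <-> I (x - y).
Proof.
split; first by move/eqmodP => /asboolP.
by move=> Ixy; apply/eqmodP/asboolP.
Qed.

Lemma quot_piK (x : quot) : quot_pi (rep x) = x.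
Proof. exact: reprK. Qed.

Lemma quot_rep x : I (rep (quot_pi x) - x).
Proof. by apply/quot_piP; rewrite quot_piK. Qed.

Lemma quot_piD x y : quot_add (quot_pi x) (quot_pi y) = quot_pi (x + y).
Proof.
apply/quot_piP; rewrite opprD addrACA.
by apply: ideal_memD; apply: quot_rep.
Qed.

Lemma quot_piN x : quot_opp (quot_pi x) = quot_pi (- x).
Proof. by apply/quot_piP; rewrite -opprD; apply: ideal_memN; apply: quot_rep. Qed.

Lemma quot_piM x y : quot_mul (quot_pi x) (quot_pi y) = quot_pi (x * y).
Proof.
apply/quot_piP; set u := rep _; set v := rep _.
have -> : u * v - x * y = (u - x) * v + x * (v - y).
  by rewrite mulrBl mulrBr subrKA.
by apply: ideal_memD; [apply: ideal_memMr|apply: ideal_memMl]; apply: quot_rep.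
Qed.

Fact quot_addA : associative quot_add.
Proof.
move=> x y z; rewrite -[x]quot_piK -[y]quot_piK -[z]quot_piK.
by rewrite !quot_piD addrA.
Qed.

Fact quot_addC : commutative quot_add.
Proof. by move=> x y; rewrite /quot_add addrC. Qed.

Fact quot_add0 : left_id (quot_pi 0) quot_add.
Proof. by move=> x; rewrite -[x]quot_piK quot_piD add0r. Qed.

Fact quot_addN : left_inverse (quot_pi 0) quot_opp quot_add.
Proof. by move=> x; rewrite -[x]quot_piK quot_piN quot_piD addNr. Qed.

HB.instance Definition _ :=
  GRing.isZmodule.Build quot quot_addA quot_addC quot_add0 quot_addN.

Fact quot_mulA : associative quot_mul.
Proof.
move=> x y z; rewrite -[x]quot_piK -[y]quot_piK -[z]quot_piK.
by rewrite !quot_piM mulrA.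
Qed.

Fact quot_mul1l : left_id (quot_pi 1) quot_mul.
Proof. by move=> x; rewrite -[x]quot_piK quot_piM mul1r. Qed.

Fact quot_mul1r : right_id (quot_pi 1) quot_mul.
Proof. by move=> x; rewrite -[x]quot_piK quot_piM mulr1. Qed.

Fact quot_mulDl : left_distributive quot_mul +%R.
Proof.
move=> x y z; rewrite -[x]quot_piK -[y]quot_piK -[z]quot_piK.
by rewrite /GRing.add /= !(quot_piM, quot_piD) mulrDl.
Qed.

Fact quot_mulDr : right_distributive quot_mul +%R.
Proof.
move=> x y z; rewrite -[x]quot_piK -[y]quot_piK -[z]quot_piK.
by rewrite /GRing.add /= !(quot_piM, quot_piD) mulrDr.
Qed.

HB.instance Definition _ := GRing.Zmodule_isPzRing.Build quot
  quot_mulA quot_mul1l quot_mul1r quot_mulDl quot_mulDr.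

Fact quot_pi_zmod_morphism : zmod_morphism quot_pi.
Proof. by move=> x y; rewrite -quot_piD -quot_piN. Qed.

Fact quot_pi_monoid_morphism : monoid_morphism quot_pi.
Proof. by split=> // x y; rewrite -quot_piM. Qed.

HB.instance Definition _ :=
  GRing.isZmodMorphism.Build A quot quot_pi quot_pi_zmod_morphism.
HB.instance Definition _ :=
  GRing.isMonoidMorphism.Build A quot quot_pi quot_pi_monoid_morphism.

End Quotient.

(* The corner ring eAe of an idempotent e, realized as {x | exe = x}; its unit
   is e. *)
Section Corner.
Variables (A : pzRingType) (e : A) (ee : e * e = e).

Definition corner_pred : {pred A} := fun x => e * x * e == x.

Record corner := Corner { corner_val : A; _ : corner_val \in corner_pred }.

HB.instance Definition _ := [isSub for corner_val].
HB.instance Definition _ := [Choice of corner by <:].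

Fact corner_zmod_closed : zmod_closed corner_pred.
Proof.
split=> [|x y]; rewrite !unfold_in; first by rewrite mulr0 mul0r.
by move=> /eqP xP /eqP yP; rewrite mulrBr mulrBl xP yP.
Qed.

HB.instance Definition _ :=
  GRing.isZmodClosed.Build A corner_pred corner_zmod_closed.
HB.instance Definition _ := [SubChoice_isSubZmodule of corner by <:].

Lemma corner_el x : x \in corner_pred -> e * x = x.
Proof. by rewrite unfold_in => /eqP <-; rewrite !mulrA ee. Qed.

Lemma corner_er x : x \in corner_pred -> x * e = x.
Proof. by rewrite unfold_in => /eqP <-; rewrite -!mulrA ee. Qed.

Fact corner_in x : e * x * e \in corner_pred.
Proof. by rewrite unfold_in !mulrA ee -!mulrA ee. Qed.

Fact corner_in1 : e \in corner_pred.
Proof. by rewrite unfold_in !ee. Qed.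

Fact corner_inM (x y : corner) : corner_val x * corner_val y \in corner_pred.
Proof.
by rewrite unfold_in mulrA (corner_el (valP x)) -mulrA (corner_er (valP y)).
Qed.

Definition corner_one := Corner corner_in1.
Definition corner_mul (x y : corner) := Corner (corner_inM x y).

Fact corner_mulA : associative corner_mul.
Proof. by move=> x y z; apply: val_inj; rewrite /= mulrA. Qed.

Fact corner_mul1l : left_id corner_one corner_mul.
Proof. by move=> x; apply: val_inj; apply: corner_el (valP x). Qed.

Fact corner_mul1r : right_id corner_one corner_mul.
Proof. by move=> x; apply: val_inj; apply: corner_er (valP x). Qed.

Fact corner_mulDl : left_distributive corner_mul +%R.
Proof. by move=> x y z; apply: val_inj; rewrite /= mulrDl. Qed.

Fact corner_mulDr : right_distributive corner_mul +%R.
Proof. by move=> x y z; apply: val_inj; rewrite /= mulrDr. Qed.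

End Corner.

(* The proof that e is idempotent is an argument of the type, so that the ring
   structure can be inferred from it. *)
Definition corner_ring (A : pzRingType) (e : A) (ee : e * e = e) := corner e.

HB.instance Definition _ (A : pzRingType) (e : A) (ee : e * e = e) :=
  GRing.Zmodule.on (corner_ring ee).
HB.instance Definition _ (A : pzRingType) (e : A) (ee : e * e = e) :=
  GRing.Zmodule_isPzRing.Build (corner_ring ee) (corner_mulA ee)
    (corner_mul1l ee) (corner_mul1r ee) (corner_mulDl ee) (corner_mulDr ee).

Section CornerIdeal.
Variables (A : pzRingType) (e : A) (ee : e * e = e) (I : ideal A).

Definition corner_ideal_mem (x : corner_ring ee) : Prop :=
  exists2 i, I i & corner_val x = e * i * e.

Fact corner_ideal0 : corner_ideal_mem 0.
Proof. by exists 0; [apply: ideal_mem0 | rewrite mulr0 mul0r]. Qed.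

Fact corner_idealD x y :
  corner_ideal_mem x -> corner_ideal_mem y -> corner_ideal_mem (x + y).
Proof.
move=> [i Ii xE] [j Ij yE]; exists (i + j); first exact: ideal_memD.
by rewrite /= xE yE mulrDr mulrDl.
Qed.

Fact corner_idealMl a x : corner_ideal_mem x -> corner_ideal_mem (a * x).
Proof.
move=> [i Ii xE]; exists (corner_val a * e * i); first exact: ideal_memMl.
by rewrite /= xE !mulrA (corner_el ee (valP a)).
Qed.

Fact corner_idealMr x a : corner_ideal_mem x -> corner_ideal_mem (x * a).
Proof.
move=> [i Ii xE]; exists (i * (e * corner_val a)); first exact: ideal_memMr.
by rewrite /= xE -!mulrA (corner_er ee (valP a)).
Qed.

Definition corner_ideal : ideal (corner_ring ee) :=
  Ideal corner_ideal0 corner_idealD corner_idealMl corner_idealMr.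

End CornerIdeal.

Section Subring.
Variables (A : pzRingType) (X : A -> Prop).

Inductive subring_mem : A -> Prop :=
| Sub_in x : X x -> subring_mem x
| Sub_1 : subring_mem 1
| Sub_B x y : subring_mem x -> subring_mem y -> subring_mem (x - y)
| Sub_M x y : subring_mem x -> subring_mem y -> subring_mem (x * y).

Definition subring_pred : {pred A} := fun x => `[< subring_mem x >].

Record subring_gen :=
  SubringGen { subring_val : A; _ : subring_val \in subring_pred }.

HB.instance Definition _ := [isSub for subring_val].
HB.instance Definition _ := [Choice of subring_gen by <:].

Fact subring_pred_closed : subring_closed subring_pred.
Proof.
split=> [|x y|x y]; rewrite !unfold_in.
- by apply/asboolP; apply: Sub_1.
- by move=> /asboolP xP /asboolP yP; apply/asboolP; apply: Sub_B.
- by move=> /asboolP xP /asboolP yP; apply/asboolP; apply: Sub_M.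
Qed.

HB.instance Definition _ :=
  GRing.isSubringClosed.Build A subring_pred subring_pred_closed.
HB.instance Definition _ :=
  GRing.SubChoice_isSubPzRing.Build A subring_pred subring_gen
    subring_pred_closed.

End Subring.

Record matroid (E : finType) := Matroid {
  indep : {set {set E}};
  indep0 : set0 \in indep;
  indepS : forall A B : {set E}, A \subset B -> B \in indep -> A \in indep;
  indep_aug : forall A B : {set E}, A \in indep -> B \in indep ->
    (#|A| < #|B|)%N -> exists2 x, x \in B :\: A & x |: A \in indep }.

Section Flats.
Variables (E : finType) (M : matroid E).
Implicit Types A B F G H J K L N X : {set E}.

Definition rank A : nat := \max_(J in indep M | J \subset A) #|J|.

Definition cl A : {set E} := [set x | rank (x |: A) == rank A].

Definition flat F : bool := cl F == F.

Definition covers K L : bool :=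
  [&& flat K, flat L, K \proper L &
    ~~ [exists X, [&& flat X, K \proper X & X \proper L]]].

Definition coloop K j : bool := (j \in K) && flat (K :\ j).

Definition cyclic_flat F : bool := flat F && ~~ [exists j, coloop F j].

(* B is a basis of the minor M^G_F. *)
Definition minor_basis F G B : bool :=
  [&& F \subset G, B \subset G :\: F, #|B| == (rank G - rank F)%N
    & cl (F :|: B) == G].

Lemma indep_le_rank A J : J \in indep M -> J \subset A -> (#|J| <= rank A)%N.
Proof. by move=> JI JA; apply: leq_bigmax_cond; rewrite JI. Qed.

Lemma rank_attained A : exists2 J, J \in indep M & J \subset A /\ #|J| = rank A.
Proof.
have P0 : (set0 \in indep M) && (set0 \subset A) by rewrite indep0 sub0set.
case: (@arg_maxnP _ set0 (fun B => (B \in indep M) && (B \subset A))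
  (fun B => #|B|) P0) => J /andP[JI JA] Jmax.
exists J => //; split=> //; apply/eqP; rewrite eqn_leq indep_le_rank //=.
by apply/bigmax_leqP => B /Jmax.
Qed.

Lemma rankS A B : A \subset B -> (rank A <= rank B)%N.
Proof.
move=> AB; have [J JI [JA <-]] := rank_attained A.
by apply: indep_le_rank => //; apply: subset_trans AB.
Qed.

Lemma rankU1 x A : (rank (x |: A) <= (rank A).+1)%N.
Proof.
have [J JI [JA <-]] := rank_attained (x |: A).
rewrite (cardsD1 x J) -add1n leq_add //; first by case: (x \in J).
apply: indep_le_rank; first by apply: indepS JI; apply: subD1set.
by rewrite subDset.
Qed.

Lemma indep_extend A J : J \in indep M -> J \subset A ->
  exists2 B, B \in indep M & [/\ J \subset B, B \subset A & #|B| = rank A].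
Proof.
move=> JI JA; have P0 : [&& J \in indep M, J \subset J & J \subset A].
  by rewrite JI JA subxx.
case: (@arg_maxnP _ _ (fun B => [&& B \in indep M, J \subset B & B \subset A])
  (fun B => #|B|) P0) => B /and3P[BI JB BA] Bmax.
exists B => //; split=> //; apply/eqP; rewrite eqn_leq indep_le_rank //=.
rewrite leqNgt; apply/negP => lt.
have [J' J'I [J'A cJ']] := rank_attained A; rewrite -cJ' in lt.
have [x /setDP[xJ' xB] xBI] := indep_aug BI J'I lt.
have := Bmax (x |: B); rewrite xBI subsetU ?JB ?orbT //= subUset sub1set.
by rewrite (subsetP J'A) // BA cardsU1 xB add1n /= ltnn => /(_ isT).
Qed.

Lemma sub_cl A : A \subset cl A.
Proof.
apply/subsetP => x xA; rewrite inE.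
by have /setUidPr -> : [set x] \subset A by rewrite sub1set.
Qed.

Lemma rank_cl A : rank (cl A) = rank A.
Proof.
apply/eqP; rewrite eqn_leq (rankS (sub_cl A)) andbT leqNgt; apply/negP => lt.
have [J JI [JA cJ]] := rank_attained A.
have [J' J'I [J'A cJ']] := rank_attained (cl A).
rewrite -cJ' -cJ in lt; have [x /setDP[xJ' xJ] xJI] := indep_aug JI J'I lt.
have := subsetP J'A x xJ'; rewrite inE => /eqP eq.
have := indep_le_rank xJI (setUS [set x] JA).
by rewrite eq -cJ cardsU1 xJ add1n ltnn.
Qed.

Lemma clS A B : A \subset B -> cl A \subset cl B.
Proof.
move=> AB; apply/subsetP => x; rewrite !inE => /eqP xA.
rewrite eqn_leq (rankS (subsetUr _ _)) andbT leqNgt; apply/negP => lt.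
have [J JI [JA cJ]] := rank_attained A.
have [C CI [JC CB cC]] := indep_extend JI (subset_trans JA AB).
have [D DI [DB cD]] := rank_attained (x |: B).
rewrite -cC -cD in lt; have [y /setDP[yD yC] yCI] := indep_aug CI DI lt.
have yx : y = x.
  have := subsetP DB y yD; rewrite !inE => /orP[/eqP // | yB].
  have := @indep_le_rank B _ yCI; rewrite subUset sub1set yB CB => /(_ isT).
  by rewrite cardsU1 yC cC add1n ltnn.
rewrite {y yD}yx in yC yCI.
have xJI := indepS (setUS [set x] JC) yCI.
have := indep_le_rank xJI (setUS [set x] JA).
by rewrite xA -cJ cardsU1 (contra (subsetP JC x) yC) add1n ltnn.
Qed.

Lemma cl_id A : cl (cl A) = cl A.
Proof.
apply/eqP; rewrite eqEsubset sub_cl andbT; apply/subsetP => x.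
rewrite [x \in cl (cl A)]inE rank_cl => /eqP xA; rewrite inE eqn_leq.
by rewrite -{1}xA !rankS ?subsetUr // setUS // sub_cl.
Qed.

Lemma flat_cl A : flat (cl A).
Proof. by rewrite /flat cl_id. Qed.

Lemma flat_rank_lt K L :
  flat K -> K \proper L -> (rank K < rank L)%N.
Proof.
move=> /eqP fK /properP[KL [x xL xK]].
apply: (@leq_trans (rank (x |: K))); last by rewrite rankS // subUset sub1set xL.
have := rankS (subsetUr [set x] K); rewrite leq_eqVlt => /orP[/eqP eq|//].
by move: xK; rewrite -fK inE eq eqxx.
Qed.

Lemma covers_rank K L : covers K L -> rank L = (rank K).+1.
Proof.
move=> /and4P[fK /eqP fL KL /existsPn nX].
apply/eqP; rewrite eqn_leq (flat_rank_lt fK KL) andbT.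
have /properP[sKL [x xL xK]] := KL.
have := nX (cl (x |: K)); rewrite flat_cl /=.
have -> /= : K \proper cl (x |: K).
  apply/properP; split; first exact: subset_trans (subsetUr _ _) (sub_cl _).
  by exists x => //; apply: (subsetP (sub_cl _)); rewrite setU11.
have sL : cl (x |: K) \subset L.
  by rewrite -fL; apply: clS; rewrite subUset sub1set xL.
by rewrite properEneq sL andbT negbK => /eqP <-; rewrite rank_cl rankU1.
Qed.

Lemma rank_covers K L :
  flat K -> flat L -> K \subset L -> rank L = (rank K).+1 -> covers K L.
Proof.
move=> fK fL KL rL; rewrite /covers fK fL /=.
have -> /= : K \proper L.
  rewrite properEneq KL andbT; apply/eqP => eq.
  by move: rL; rewrite eq => /n_Sn.
apply/existsPn => X; apply/negP => /and3P[fX KX XL].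
have := flat_rank_lt fX XL; rewrite rL ltnS leqNgt.
by rewrite (flat_rank_lt fK KX).
Qed.

Lemma covers_meet K K' L :
  covers K L -> covers K' L -> covers (K :&: K') K -> covers (K :&: K') K'.
Proof.
move=> KL K'L NK; have [fN fK'] := (and4P NK, and4P K'L).
apply: rank_covers; [by case: fN | by case: fK' | exact: subsetIr |].
have := covers_rank K'L; rewrite (covers_rank KL) => -[<-].
exact: covers_rank NK.
Qed.

Lemma covers_coloop K j : flat K -> coloop K j -> covers (K :\ j) K.
Proof.
move=> fK /andP[jK fL]; apply: rank_covers => //; first exact: subD1set.
apply/eqP; rewrite eqn_leq -{1}(setD1K jK) rankU1 /=.
by rewrite flat_rank_lt // properD1.
Qed.

Lemma minor_basisU F G H S T :
  minor_basis G H S -> minor_basis F G T -> minor_basis F H (S :|: T).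
Proof.
move=> /and4P[GH SH /eqP cS /eqP clS'] /and4P[FG TG /eqP cT /eqP clT].
apply/and4P; split.
- exact: subset_trans GH.
- rewrite subUset (subset_trans SH) ?setDS //=.
  by rewrite (subset_trans TG) // setSD.
- have dST : [disjoint S & T].
    rewrite disjoints_subset (subset_trans SH) // setDE.
    apply: subset_trans (subsetIr _ _) _; rewrite setCS.
    exact: subset_trans TG (subsetDl _ _).
  rewrite cardsU disjoint_setI0 // cards0 subn0 cS cT.
  by rewrite addnBA ?rankS // subnK ?rankS.
- have FSH : F :|: (S :|: T) \subset H.
    rewrite !subUset (subset_trans FG GH) (subset_trans SH (subsetDl _ _)) /=.
    exact: subset_trans TG (subset_trans (subsetDl _ _) GH).
  have fH : cl H = H by rewrite -clS' cl_id.
  have FTG : G \subset cl (F :|: T) by rewrite clT.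
  have sH := clS FSH; rewrite fH in sH; rewrite eqEsubset sH /=.
  have : G :|: S \subset cl (F :|: (S :|: T)).
    rewrite subUset; apply/andP; split.
      by apply: subset_trans FTG (clS _); rewrite setUS // subsetUr.
    by apply: subset_trans (sub_cl _); rewrite setUCA subsetUl.
  by move/clS; rewrite clS' cl_id.
Qed.

End Flats.

Section PathAlgebra.
Variables (E : finType) (M : matroid E).
Implicit Types K L X : {set E}.

Definition adjacent K L : bool := covers M K L || covers M L K.

Definition is_flagpath (s : seq {set E}) : bool :=
  if s is K :: s' then flat M K && path adjacent K s' else false.

Record flagpath :=
  FlagPath { flagpath_seq :> seq {set E}; _ : is_flagpath flagpath_seq }.

HB.instance Definition _ := [isSub for flagpath_seq].
HB.instance Definition _ := [Choice of flagpath by <:].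

Definition pathalg := {malg int[flagpath]}.

HB.instance Definition _ := GRing.Lmodule.on pathalg.

(* The basis element of the flag path s (and 0 if s is not a flag path). *)
Definition path_elt (s : seq {set E}) : pathalg :=
  if insub s is Some p then << (p : flagpath) >> else 0.

Definition path_cat (p q : flagpath) : pathalg :=
  if last set0 p == head set0 q then path_elt (p ++ behead q) else 0.

Definition pathalg_mul (f g : pathalg) : pathalg :=
  \sum_(p <- msupp f) \sum_(q <- msupp g) (f@_p * g@_q) *: path_cat p q.

Definition pathalg_one : pathalg := \sum_(K | flat M K) path_elt [:: K].

Lemma path_eltE (p : flagpath) : path_elt p = << p >>.
Proof. by rewrite /path_elt valK. Qed.

Variant path_cat_spec (p q : flagpath) : pathalg -> Prop :=
| PathCat (r : flagpath) of last set0 p = head set0 q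
    & val r = p ++ behead q : path_cat_spec p q << r >>
| PathCat0 of last set0 p <> head set0 q : path_cat_spec p q 0.

Lemma path_catP p q : path_cat_spec p q (path_cat p q).
Proof.
rewrite /path_cat; case: eqP => pq; last exact: PathCat0.
suff pqP : is_flagpath (p ++ behead q).
  rewrite -[p ++ _]/(val (FlagPath pqP)) path_eltE.
  exact: PathCat.
move: pq; case: p q => [[|K s] //= sP] [[|L t] //= tP] /= KL.
case/andP: sP => -> sP; case/andP: tP => fL tP.
by rewrite cat_path sP KL.
Qed.

Lemma path_cat_headl (p q r : flagpath) :
  val r = p ++ behead q -> head set0 r = head set0 p.
Proof. by case: p => [[|K s] //= _] ->. Qed.

Lemma path_cat_lastr (p q r : flagpath) : last set0 p = head set0 q ->
  val r = p ++ behead q -> last set0 r = last set0 q.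
Proof.
move=> pq -> /=; rewrite last_cat pq.
by case: q {pq} => [[|L t]].
Qed.

Lemma pathalg_mulw (d1 d2 : {fset flagpath}) (f g : pathalg) :
  (msupp f `<=` d1)%fset -> (msupp g `<=` d2)%fset ->
  pathalg_mul f g =
    \sum_(p <- d1) \sum_(q <- d2) (f@_p * g@_q) *: path_cat p q.
Proof.
move=> le1 le2; rewrite /pathalg_mul (big_fset_incl _ le1) /=; last first.
  move=> p _ /mcoeff_outdom fp; rewrite big1 // => q _.
  by rewrite fp mul0r scale0r.
apply: eq_bigr => p _; apply: big_fset_incl => // q _ /mcoeff_outdom ->.
by rewrite mulr0 scale0r.
Qed.

Lemma pathalg_mulDl : left_distributive pathalg_mul +%R.
Proof.
move=> f g h; rewrite (pathalg_mulw (msuppD_le f g) (fsubset_refl _)).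
rewrite (pathalg_mulw (fsubsetUl _ (msupp g)) (fsubset_refl _)).
rewrite (pathalg_mulw (fsubsetUr (msupp f) _) (fsubset_refl _)).
rewrite -big_split /=; apply: eq_bigr => p _.
rewrite -big_split /=; apply: eq_bigr => q _.
by rewrite mcoeffD mulrDl scalerDl.
Qed.

Lemma pathalg_mulDr : right_distributive pathalg_mul +%R.
Proof.
move=> h f g; rewrite (pathalg_mulw (fsubset_refl _) (msuppD_le f g)).
rewrite (pathalg_mulw (fsubset_refl _) (fsubsetUl _ (msupp g))).
rewrite (pathalg_mulw (fsubset_refl _) (fsubsetUr (msupp f) _)).
rewrite -big_split /=; apply: eq_bigr => p _.
rewrite -big_split /=; apply: eq_bigr => q _.
by rewrite mcoeffD mulrDr scalerDl.
Qed.

Lemma pathalg_mul0l : left_zero 0 pathalg_mul.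
Proof. by move=> f; rewrite /pathalg_mul msupp0 big_seq_fset0. Qed.

Lemma pathalg_mul0r : right_zero 0 pathalg_mul.
Proof.
by move=> f; rewrite /pathalg_mul big1 // => p _; rewrite msupp0 big_seq_fset0.
Qed.

Lemma pathalg_mulZl (c : int) f g :
  pathalg_mul (c *: f) g = c *: pathalg_mul f g.
Proof.
rewrite (pathalg_mulw (msuppZ_le c f) (fsubset_refl _)) scaler_sumr.
apply: eq_bigr => p _; rewrite scaler_sumr; apply: eq_bigr => q _.
by rewrite mcoeffZ scalerA mulrA.
Qed.

Lemma pathalg_mulZr (c : int) f g :
  pathalg_mul f (c *: g) = c *: pathalg_mul f g.
Proof.
rewrite (pathalg_mulw (fsubset_refl _) (msuppZ_le c g)) scaler_sumr.
apply: eq_bigr => p _; rewrite scaler_sumr; apply: eq_bigr => q _.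
by rewrite mcoeffZ scalerA mulrCA.
Qed.

Lemma pathalg_mulU (p q : flagpath) :
  pathalg_mul << p >> << q >> = path_cat p q.
Proof.
by rewrite /pathalg_mul !msuppU oner_eq0 !big_seq_fset1 !mcoeffUU mulr1 scale1r.
Qed.

Lemma pathalg_ind (P : pathalg -> Prop) :
  P 0 -> (forall f g, P f -> P g -> P (f + g)) ->
  (forall (c : int) p, P (c *: (<< p >> : pathalg))) -> forall f, P f.
Proof.
move=> P0 PD PZ f; rewrite [f]monalgE; elim/big_ind: _ => // p _.
have -> : << f@_p *g p >> = f@_p *: (<< p >> : pathalg); last exact: PZ.
by apply/malgP => q; rewrite mcoeffZ !mcoeffU mulr_natr.
Qed.

Lemma pathalg_mulA : associative pathalg_mul.
Proof.
move=> f g h; elim/pathalg_ind: f => [|f1 f2 IH1 IH2|c p].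
- by rewrite !pathalg_mul0l.
- by rewrite !pathalg_mulDl IH1 IH2.
rewrite !pathalg_mulZl; congr (_ *: _).
elim/pathalg_ind: g => [|g1 g2 IH1 IH2|c' q].
- by rewrite pathalg_mul0l pathalg_mul0r pathalg_mul0l.
- by rewrite !(pathalg_mulDl, pathalg_mulDr) IH1 IH2.
rewrite !(pathalg_mulZl, pathalg_mulZr); congr (_ *: _).
elim/pathalg_ind: h => [|h1 h2 IH1 IH2|c'' r].
- by rewrite !pathalg_mul0r.
- by rewrite !pathalg_mulDr IH1 IH2.
rewrite !pathalg_mulZr; congr (_ *: _); rewrite !pathalg_mulU.
case: (path_catP p q) => [s pq sE|pq]; case: (path_catP q r) => [t qr tE|qr].
- rewrite !pathalg_mulU /path_cat (path_cat_lastr pq sE) qr (path_cat_headl tE).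
  rewrite pq !eqxx tE sE -catA; congr (path_elt (_ ++ _)).
  by case: (q) => [[|L u]].
- rewrite pathalg_mul0r pathalg_mulU /path_cat (path_cat_lastr pq sE).
  by case: eqP.
- rewrite pathalg_mul0l pathalg_mulU /path_cat (path_cat_headl tE).
  by case: eqP.
- by rewrite pathalg_mul0l pathalg_mul0r.
Qed.

Lemma flat_path_elt K : flat M K ->
  exists2 p : flagpath, val p = [:: K] & path_elt [:: K] = << p >>.
Proof.
move=> fK; have KP : is_flagpath [:: K] by rewrite /= fK.
by exists (FlagPath KP) => //; rewrite -[[:: K]]/(val (FlagPath KP)) path_eltE.
Qed.

Lemma pathalg_mul1l : left_id pathalg_one pathalg_mul.
Proof.
elim/pathalg_ind => [|f g IH1 IH2|c p]; first by rewrite pathalg_mul0r.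
  by rewrite pathalg_mulDr IH1 IH2.
rewrite pathalg_mulZr; congr (_ *: _); have fp : flat M (head set0 p).
  by case: p => [[|K s] //= /andP[]].
rewrite /pathalg_one (big_morph (pathalg_mul^~ _)
  (fun f g => pathalg_mulDl f g _) (pathalg_mul0l _)).
rewrite (bigD1 (head set0 p)) //= big1 ?addr0 => [|K /andP[fK /eqP Kp]].
  have [q qE ->] := flat_path_elt fp.
  rewrite pathalg_mulU /path_cat qE /= eqxx -path_eltE.
  by case: (p) => [[|K s]].
have [q qE ->] := flat_path_elt fK; rewrite pathalg_mulU /path_cat qE /=.
by case: eqP.
Qed.

Lemma pathalg_mul1r : right_id pathalg_one pathalg_mul.
Proof.
elim/pathalg_ind => [|f g IH1 IH2|c p]; first by rewrite pathalg_mul0l.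
  by rewrite pathalg_mulDl IH1 IH2.
rewrite pathalg_mulZl; congr (_ *: _); have fp : flat M (last set0 p).
  case: p => [[|K s] //= /andP[fK]]; elim: s K fK => //= L s IH K fK.
  by case/andP=> /orP[] /and4P[fK' fL _ _]; apply: IH.
rewrite /pathalg_one (big_morph (pathalg_mul _)
  (fun f g => pathalg_mulDr _ f g) (pathalg_mul0r _)).
rewrite (bigD1 (last set0 p)) //= big1 ?addr0 => [|K /andP[fK /eqP Kp]].
  have [q qE ->] := flat_path_elt fp.
  by rewrite pathalg_mulU /path_cat qE /= eqxx -path_eltE cats0.
have [q qE ->] := flat_path_elt fK; rewrite pathalg_mulU /path_cat qE /=.
by case: eqP => // pK; case: Kp.
Qed.

HB.instance Definition _ := GRing.Zmodule_isPzRing.Build pathalg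
  pathalg_mulA pathalg_mul1l pathalg_mul1r pathalg_mulDl pathalg_mulDr.

Lemma path_elt_idem K : flat M K ->
  path_elt [:: K] * path_elt [:: K] = path_elt [:: K].
Proof.
move=> fK; have [p pE ->] := flat_path_elt fK.
by rewrite [LHS]pathalg_mulU /path_cat pE /= eqxx -pE path_eltE.
Qed.

Lemma path_elt_orth K L : flat M K -> flat M L -> K != L ->
  path_elt [:: K] * path_elt [:: L] = 0.
Proof.
move=> fK fL KL; have [p pE ->] := flat_path_elt fK.
have [q qE ->] := flat_path_elt fL.
by rewrite [LHS]pathalg_mulU /path_cat pE qE /= (negPf KL).
Qed.

End PathAlgebra.

Section FlagAlgebra.
Variables (E : finType) (M : matroid E).
Implicit Types (K L X : {set E}) (j : E).
Local Notation "<[ s ]>" := (path_elt M s).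

(* The right-hand side of the relation for K < L > K'; in its second case
   K :&: K' is also covered by K', see covers_meet. *)
Definition meet_rhs K K' L : pathalg M :=
  if K == K' then <[ [:: K] ]> *+ #|L :\: K|
  else if covers M (K :&: K') K then - <[ [:: K; K :&: K'; K'] ]>
  else 0.

Inductive flag_rel : pathalg M -> Prop :=
| Rel_FS_up L K of flat M L & flat M K & L \proper K
    & rank M K = (rank M L).+2 :
    flag_rel (\sum_(X | covers M L X && covers M X K) <[ [:: L; X; K] ]>)
| Rel_FS_down L K of flat M L & flat M K & L \proper K
    & rank M K = (rank M L).+2 :
    flag_rel (\sum_(X | covers M L X && covers M X K) <[ [:: K; X; L] ]>)
| Rel_meet K K' L of covers M K L & covers M K' L :
    flag_rel (<[ [:: K; L; K'] ]> - meet_rhs K K' L).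

Definition flag_alg := quot (ideal_gen flag_rel).

HB.instance Definition _ := GRing.PzRing.on flag_alg.

Definition flag_elt (s : seq {set E}) : flag_alg :=
  quot_pi (ideal_gen flag_rel) (path_elt M s).

Definition cyclic_idem : flag_alg :=
  \sum_(K | cyclic_flat M K) flag_elt [:: K].

Lemma flag_elt1M K L : flat M K -> flat M L ->
  flag_elt [:: K] * flag_elt [:: L] =
    if K == L then flag_elt [:: K] else 0.
Proof.
move=> fK fL; rewrite /flag_elt -[LHS]rmorphM /=; case: eqP => [->|/eqP KL].
  by rewrite path_elt_idem.
by rewrite path_elt_orth ?rmorph0.
Qed.

Lemma cyclic_idemP : cyclic_idem * cyclic_idem = cyclic_idem.
Proof.
rewrite {1}/cyclic_idem mulr_suml; apply: eq_bigr => K cK.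
have fK : flat M K by case/andP: cK.
rewrite /cyclic_idem mulr_sumr (bigD1 K) //= flag_elt1M // eqxx.
rewrite big1 ?addr0 // => L /andP[/andP[fL _] LK].
by rewrite flag_elt1M // eq_sym (negPf LK).
Qed.

Inductive join_rel : flag_alg -> Prop :=
| Rel_join K j of flat M K & coloop M K j :
    join_rel (flag_elt [:: K; K :\ j; K] - flag_elt [:: K]).

Definition cyclic_corner := corner_ring cyclic_idemP.

HB.instance Definition _ := GRing.PzRing.on cyclic_corner.

Definition cyclic_flag_quot :=
  quot (corner_ideal cyclic_idemP (ideal_gen join_rel)).

HB.instance Definition _ := GRing.PzRing.on cyclic_flag_quot.

Lemma meet_flagpath K K' L : covers M K L -> covers M K' L ->
  covers M (K :&: K') K -> is_flagpath M [:: K; K :&: K'; K'].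
Proof.
move=> KL K'L NK; have NK' := covers_meet KL K'L NK.
by case/and4P: (NK) => _ fK _ _; rewrite /= /adjacent fK NK NK' orbT.
Qed.

Lemma coloop_flagpath K j : flat M K -> coloop M K j ->
  is_flagpath M [:: K; K :\ j; K].
Proof.
by move=> fK jK; rewrite /= /adjacent fK (covers_coloop fK jK) orbT.
Qed.

End FlagAlgebra.

(* The exterior algebra over int on E, in the basis of the monomials e_S:
   u S is the coefficient of e_S in u. For disjoint S and T, reordering
   e_S /\ e_T into e_(S :|: T) costs one sign for each pair (s, t) with t < s. *)
Section Exterior.
Variables (d : Order.disp_t) (E : finOrderType d).
Implicit Types A S T U : {set E}.

Definition ext := {ffun {set E} -> int}.

HB.instance Definition _ := GRing.Zmodule.on ext.

Definition ext_mon S : ext := [ffun U : {set E} => (U == S)%:R].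

Definition inversions S T : nat :=
  #|[set p : E * E | [&& p.1 \in S, p.2 \in T & (p.2 < p.1)%O]]|.

Definition wedge (u v : ext) : ext :=
  [ffun U : {set E} => \sum_(S : {set E}) \sum_(T : {set E} | [disjoint S & T] && (S :|: T == U))
     (-1) ^+ inversions S T * u S * v T].

Definition ext_sum A : ext := \sum_(s in A) ext_mon [set s].

Lemma wedge_is_bilinear :
  (forall v, additive (wedge^~ v)) /\ (forall u, additive (wedge u)).
Proof.
split=> [v u1 u2 | u v1 v2]; apply/ffunP => U; rewrite !ffunE;
  rewrite -sumrB; apply: eq_bigr => S _;
  rewrite -sumrB; apply: eq_bigr => T _; rewrite !ffunE.
- by rewrite mulrBr mulrBl.
- by rewrite mulrBr.
Qed.

Lemma wedge_mon S T U : wedge (ext_mon S) (ext_mon T) U =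
  if [disjoint S & T] && (S :|: T == U) then (-1) ^+ inversions S T else 0.
Proof.
rewrite ffunE (bigD1 S) //= [X in _ + X]big1 ?addr0; last first.
  move=> S' S'S; apply: big1 => T' _.
  by rewrite !ffunE (negPf S'S) mulr0 mul0r.
rewrite big_mkcond (bigD1 T) //= [X in _ + X]big1 ?addr0; last first.
  by move=> T' T'T; rewrite [ext_mon T T']ffunE (negPf T'T) mulr0 if_same.
by rewrite !ffunE !eqxx !mulr1.
Qed.

End Exterior.

Section MatroidalSchurAlgebra.
Variables (d : Order.disp_t) (E : finOrderType d) (M : matroid E).
Implicit Types F G H B : {set E}.

(* The index ((F, G), B) stands for the monomial e_B in the summand B^G_F. *)
Definition basis_index := {t : {set E} * {set E} * {set E} |
  [&& cyclic_flat M t.1.1, cyclic_flat M t.1.2 & minor_basis M t.1.1 t.1.2 t.2]}.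

Definition bmod := {ffun basis_index -> int^o}.

HB.instance Definition _ := Vector.on bmod.

(* The B^G_F-component of x, as an element of the exterior algebra. *)
Definition comp F G (x : bmod) : ext E :=
  [ffun B : {set E} =>
     (if insub (F, G, B) : option basis_index is Some i then x i else 0) : int].

Definition bform (x y : bmod) : int := \sum_i x i * y i.

(* See comp_star: no coefficient of the wedge products is lost here. *)
Definition star (x y : bmod) : bmod :=
  [ffun i : basis_index => let: (F, H, B) := val i in
     \sum_(G : {set E} | cyclic_flat M G) wedge (comp G H x) (comp F G y) B].

(* The product of bend is the composition of endomorphisms. *)
Definition bend := 'End(bmod).

HB.instance Definition _ := GRing.Zmodule.on bend.
HB.instance Definition _ := GRing.Zmodule_isPzRing.Build bend
  (@comp_lfunA _ _ _ _ _) (@comp_lfun1l _ _ _) (@comp_lfun1r _ _ _)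
  (@comp_lfunDl _ _ _ _) (@comp_lfunDr _ _ _ _).

Definition bmon (i : basis_index) : bmod := [ffun j => (j == i)%:R].

Definition mu (b : bmod) : bend := linfun (star b).

(* See adjointP. *)
Definition adj_fun (f : bend) (x : bmod) : bmod :=
  [ffun i => bform (f (bmon i)) x].

Definition adjoint (f : bend) : bend := linfun (adj_fun f).

Definition kappa (b : bmod) : bend := adjoint (mu b).

Definition in_checkU (x : bmod) : Prop :=
  forall F G, cyclic_flat M F -> cyclic_flat M G -> F \subset G ->
    wedge (ext_sum (G :\: F)) (comp F G x) = 0.

Definition schur_gen (f : bend) : Prop :=
  exists2 u, in_checkU u & f = mu u \/ f = kappa u.

(* Closing under 1 adds nothing: the identity is the sum over the cyclic flats F
   of mu (e_set0), where e_set0 is taken in B^F_F. *)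
Definition matroidal_schur := subring_gen schur_gen.

HB.instance Definition _ := GRing.PzRing.on matroidal_schur.

Lemma comp0_out F G x B :
  ~~ minor_basis M F G B -> comp F G x B = 0.
Proof.
move=> nB; rewrite ffunE; case: insubP => // i /and3P[_ _ /= bB].
by rewrite bB in nB.
Qed.

Lemma comp_star F H x y : cyclic_flat M F -> cyclic_flat M H ->
  comp F H (star x y) =
    \sum_(G | cyclic_flat M G) wedge (comp G H x) (comp F G y).
Proof.
move=> cF cH; apply/ffunP => B; rewrite sum_ffunE ffunE.
case: insubP => [i _ iE|]; first by rewrite ffunE iE.
rewrite /= cF cH /= => nB; rewrite big1 // => G cG; rewrite ffunE.
rewrite big1 // => S _; rewrite big1 // => T /andP[_ /eqP STB].
have [bS|nS] := boolP (minor_basis M G H S); last first.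
  by rewrite comp0_out // mulr0 mul0r.
have [bT|nT] := boolP (minor_basis M F G T); last by rewrite (comp0_out _ nT) mulr0.
by rewrite -STB (minor_basisU bS bT) in nB.
Qed.

Lemma comp_linear F G (a : int) x y B :
  comp F G (a *: x + y) B = a * comp F G x B + comp F G y B.
Proof. by rewrite !ffunE; case: insub => [i|]; rewrite ?mulr0 ?addr0 ?ffunE. Qed.

Lemma star_linear b : linear (star b).
Proof.
move=> a x y; apply/ffunP => i; rewrite !ffunE.
case: (val i) => [[F H] B]; rewrite -[X in _ = X + _]/(a * _) mulr_sumr -big_split /=.
apply: eq_bigr => G _; rewrite !ffunE mulr_sumr -big_split /=.
apply: eq_bigr => S _; rewrite mulr_sumr -big_split /=.
apply: eq_bigr => T _; rewrite comp_linear mulrDr; congr (_ + _).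
by rewrite mulrCA.
Qed.

HB.instance Definition _ b :=
  GRing.isLinear.Build int bmod bmod _ (star b) (star_linear b).

Lemma muE b x : mu b x = star b x.
Proof. exact: lfunE. Qed.

Lemma adj_fun_linear f : linear (adj_fun f).
Proof.
move=> a x y; apply/ffunP => i; rewrite !ffunE /bform -[X in _ = X + _]/(a * _).
rewrite mulr_sumr -big_split; apply: eq_bigr => j _ /=.
by rewrite !ffunE mulrDr; congr (_ + _); rewrite mulrCA.
Qed.

HB.instance Definition _ f :=
  GRing.isLinear.Build int bmod bmod _ (adj_fun f) (adj_fun_linear f).

Lemma bmonE (x : bmod) : x = \sum_i (x i : int) *: bmon i.
Proof.
apply/ffunP => j; rewrite sum_ffunE (bigD1 j) //= big1 => [|i ij].
  by rewrite !ffunE eqxx addr0 -[_ *: _]/(_ * _) mulr1.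
by rewrite !ffunE eq_sym (negPf ij) scaler0.
Qed.

Lemma adjointP f x y : bform (adjoint f x) y = bform x (f y).
Proof.
rewrite lfunE /=.
rewrite {2}[y]bmonE linear_sum /bform.
have fE j : (\sum_i f ((y i : int) *: bmon i)) j =
    \sum_i (y i : int) * (f (bmon i) j : int).
  by rewrite sum_ffunE; apply: eq_bigr => i _; rewrite linearZ /= ffunE.
under [RHS]eq_bigr => j _ do rewrite fE mulr_sumr.
rewrite exchange_big; apply: eq_bigr => i _ /=; rewrite ffunE /bform mulr_suml.
by apply: eq_bigr => j _; rewrite mulrC [RHS]mulrCA [X in _ = _ * X]mulrC.
Qed.

End MatroidalSchurAlgebra.

(* Main.v *)
(* S(M) acts on the sum of the modules B^G_F over all flats G, for each fixed
   cyclic flat F: a step (K > L) acts as the wedge product with the sum of the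
   elements of K \ L, and (L < K) as its adjoint. The relations (FS) and (meet)
   hold for this action, and (join) does because F is cyclic. Compressing to the
   cyclic flats G gives a ring morphism from eSe/eIe to End(B).
   The meet relation rewrites every path as a combination of paths that first
   descend and then ascend, and the join relation makes the lowest flat of such a
   path cyclic. Hence eSe/eIe is generated by descending and ascending flags
   between cyclic flats. A descending flag from K to N acts as mu of its flag
   form, the wedge product of the sums of its successive differences, and flag
   forms span the module checkU^K_N, so the image is the Schur algebra.
   Injectivity rests on the duality between flags and top degree Orlik-Solomon
   elements: flags from K to N modulo (FS) are determined by the coefficients of
   their flag forms. Both facts are proved by fixing a in K \ N and running over
   the hyperplanes H of K that contain N but not a. *)
Require Import Defs.
From HB Require Import structures.
From mathcomp Require Import all_boot all_order all_algebra finmap ring.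
From mathcomp.multinomials Require Import monalg.
From mathcomp.classical Require Import boolp.

Set Implicit Arguments.
Unset Strict Implicit.
Unset Printing Implicit Defensive.

Import Order.TTheory GRing.Theory Num.Theory.

Local Open Scope ring_scope.

(** All modules are over the integers, so a count of ranks would not settle spanning or
    independence. The inductions over hyperplanes that avoid a work integrally because the only
    coefficients they have to invert are signs. The join relation serves only to make the lowest
    flat cyclic. After that nothing of I is left: for fixed ends K and K', a combination of down-up
    paths with cyclic bottoms that acts as zero is already 0 in S(M). The reason is a triangularity:
    a path with bottom N can act on the F-part only if F is contained in N, so when F is a bottom of
    largest cardinality, the F-part sees no other bottom. Compression to cyclic flats is not
    multiplicative on S(M): the compressions of f and g multiply to that of f e g. The isomorphism
    is therefore described through lifts to the path algebra: an endomorphism and a class correspond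
    if they come from a common lift, and products of lifts are taken with e in the middle. *)

(** * Subgroups given by predicates *)

Lemma additive_pred_Mz (V : zmodType) (P : V -> Prop) : P 0 ->
  (forall x y, P x -> P y -> P (x - y)) -> forall x (c : int), P x -> P (x *~ c).
Proof.
move=> P0 PB x c Px.
have PN y : P y -> P (- y) by rewrite -sub0r; apply: PB.
have Pn n : P (x *+ n).
  by elim: n => [|n IH] //; rewrite mulrSr -[x in _ + x]opprK; apply/PB/PN.
by case: c => n; [exact: Pn | apply/PN/Pn].
Qed.

Lemma additive_pred_sum (V : zmodType) (P : V -> Prop) : P 0 ->
  (forall x y, P x -> P y -> P (x - y)) ->
  forall (I : Type) (r : seq I) (Q : pred I) (f : I -> V),
    (forall i, Q i -> P (f i)) -> P (\sum_(i <- r | Q i) f i).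
Proof.
move=> P0 PB I r Q f Pf; apply: big_ind => // x y Px Py.
by rewrite -[y]opprK; apply: (PB) => //; rewrite -sub0r; apply: PB.
Qed.

(** * Exterior algebra over the integers: associativity, signs, elements of degree one *)

Section ExteriorTheory.
Variables (d : Order.disp_t) (E : finOrderType d).
Implicit Types (A B S T U : {set E}) (s t : E) (u v w : ext E).

Lemma wedge_is_zmod_morphism u : zmod_morphism (wedge u).
Proof. by case: (@wedge_is_bilinear d E) => _ /(_ u). Qed.

HB.instance Definition _ u :=
  GRing.isZmodMorphism.Build (ext E) (ext E) (wedge u)
    (wedge_is_zmod_morphism u).

Definition wedge_by v u := wedge u v.

Lemma wedge_by_is_zmod_morphism v : zmod_morphism (wedge_by v).
Proof. by case: (@wedge_is_bilinear d E) => /(_ v). Qed.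

HB.instance Definition _ v :=
  GRing.isZmodMorphism.Build (ext E) (ext E) (wedge_by v)
    (wedge_by_is_zmod_morphism v).

Lemma wedge0l v : wedge 0 v = 0.
Proof. exact: (raddf0 (wedge_by v)). Qed.

Lemma wedge0r u : wedge u 0 = 0.
Proof. exact: raddf0. Qed.

Lemma wedgeDr u v1 v2 : wedge u (v1 + v2) = wedge u v1 + wedge u v2.
Proof. exact: raddfD. Qed.

Lemma wedgeBr u v1 v2 : wedge u (v1 - v2) = wedge u v1 - wedge u v2.
Proof. exact: raddfB. Qed.

Lemma wedgeMzr u v (c : int) : wedge u (v *~ c) = wedge u v *~ c.
Proof. exact: raddfMz. Qed.

Lemma wedge_sumr (I : Type) (r : seq I) (P : pred I) (f : I -> ext E) u :
  wedge u (\sum_(i <- r | P i) f i) = \sum_(i <- r | P i) wedge u (f i).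
Proof. exact: raddf_sum. Qed.

Lemma wedgeBl u1 u2 v : wedge (u1 - u2) v = wedge u1 v - wedge u2 v.
Proof. exact: (raddfB (wedge_by v)). Qed.

Lemma wedgeMzl u v (c : int) : wedge (u *~ c) v = wedge u v *~ c.
Proof. exact: (raddfMz (wedge_by v)). Qed.

Lemma wedge_suml (I : Type) (r : seq I) (P : pred I) (f : I -> ext E) v :
  wedge (\sum_(i <- r | P i) f i) v = \sum_(i <- r | P i) wedge (f i) v.
Proof. exact: (raddf_sum (wedge_by v)). Qed.

Definition ext_coef S u : int := u S.

Lemma ext_coef_is_zmod_morphism S : zmod_morphism (ext_coef S).
Proof. by move=> u v; rewrite /ext_coef !ffunE. Qed.

HB.instance Definition _ S :=
  GRing.isZmodMorphism.Build (ext E) int (ext_coef S)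
    (ext_coef_is_zmod_morphism S).

Lemma ext_MzE u (c : int) S : (u *~ c) S = u S * c.
Proof. by rewrite -[LHS]/(ext_coef S _) raddfMz mulrzz. Qed.

Lemma ext_sumE (I : Type) (r : seq I) (P : pred I) (f : I -> ext E) S :
  (\sum_(i <- r | P i) f i) S = \sum_(i <- r | P i) f i S.
Proof. exact: (raddf_sum (ext_coef S)). Qed.

Lemma ext_expand u : u = \sum_S ext_mon S *~ u S.
Proof.
apply/ffunP => S; rewrite ext_sumE (bigD1 S) //= big1 ?addr0 => [|T TS].
  by rewrite ext_MzE ffunE eqxx mul1r.
by rewrite ext_MzE ffunE eq_sym (negPf TS) mul0r.
Qed.

Lemma ext_ind (P : ext E -> Prop) : P 0 -> (forall u v, P u -> P v -> P (u + v)) ->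
  (forall S (c : int), P (ext_mon S *~ c)) -> forall u, P u.
Proof. by move=> P0 PD Pm u; rewrite [u]ext_expand; elim/big_ind: _. Qed.

Lemma wedge_monE S T : wedge (ext_mon S) (ext_mon T) =
  if [disjoint S & T] then ext_mon (S :|: T) *~ (-1) ^+ inversions S T else 0.
Proof.
apply/ffunP => U; rewrite wedge_mon; case: ifP => /andP.
  by case=> -> /eqP ->; rewrite ext_MzE ffunE eqxx mul1r.
case: ifP => [_ nU|_ _]; last by rewrite ffunE.
rewrite ext_MzE ffunE; case: eqP => [US|]; last by rewrite mul0r.
by case: nU; rewrite US.
Qed.

Lemma setU_disjointl S T U :
  [disjoint S :|: T & U] = [disjoint S & U] && [disjoint T & U].
Proof. by rewrite -!setI_eq0 setIUl setU_eq0. Qed.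

Lemma setU_disjointr S T U :
  [disjoint S & T :|: U] = [disjoint S & T] && [disjoint S & U].
Proof. by rewrite -!setI_eq0 setIUr setU_eq0. Qed.

Lemma inversionsUl S T U : [disjoint S & T] ->
  inversions (S :|: T) U = (inversions S U + inversions T U)%N.
Proof.
move=> dST; rewrite /inversions -cardsUI; set X := (X in (_ + #|pred_of_set X|)%N).
have -> : X = set0.
  apply/setP => -[a b]; rewrite !inE /=; apply/negP.
  case/andP=> /andP[aS _] /andP[aT _].
  by rewrite (disjointFr dST aS) in aT.
by rewrite cards0 addn0; apply: eq_card => -[a b]; rewrite !inE /= andb_orl.
Qed.

Lemma inversionsUr S T U : [disjoint T & U] ->
  inversions S (T :|: U) = (inversions S T + inversions S U)%N.
Proof.
move=> dTU; rewrite /inversions -cardsUI; set X := (X in (_ + #|pred_of_set X|)%N).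
have -> : X = set0.
  apply/setP => -[a b]; rewrite !inE /=; apply/negP.
  case/andP=> /and3P[_ bT _] /and3P[_ bU _].
  by rewrite (disjointFr dTU bT) in bU.
rewrite cards0 addn0; apply: eq_card => -[a b].
by rewrite !inE /= andb_orl andb_orr.
Qed.

Lemma wedgeDl u1 u2 v : wedge (u1 + u2) v = wedge u1 v + wedge u2 v.
Proof. exact: (raddfD (wedge_by v)). Qed.

Lemma wedgeA u v w : wedge u (wedge v w) = wedge (wedge u v) w.
Proof.
elim/ext_ind: u => [|u1 u2 IH1 IH2|S c]; first by rewrite !wedge0l.
  by rewrite !wedgeDl IH1 IH2.
rewrite !wedgeMzl; congr (_ *~ _).
elim/ext_ind: v => [|u1 u2 IH1 IH2|T c2].
- by rewrite wedge0l !wedge0r wedge0l.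
- by rewrite !(wedgeDl, wedgeDr) /= IH1 IH2.
rewrite wedgeMzl !wedgeMzr wedgeMzl; congr (_ *~ _).
elim/ext_ind: w => [|u1 u2 IH1 IH2|U c3]; first by rewrite !wedge0r.
  by rewrite !wedgeDr /= IH1 IH2.
rewrite !wedgeMzr; congr (_ *~ _); rewrite !wedge_monE.
have [dTU|nTU] := boolP [disjoint T & U]; last first.
  rewrite wedge0r; case: ifP => _; last by rewrite wedge0l.
  by rewrite wedgeMzl wedge_monE setU_disjointl (negPf nTU) andbF mul0rz.
have [dST|nST] := boolP [disjoint S & T]; last first.
  by rewrite wedgeMzr wedge0l wedge_monE setU_disjointr (negPf nST) mul0rz.
rewrite wedgeMzr wedgeMzl !wedge_monE setU_disjointl setU_disjointr dST dTU andbT /=.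
case: ifP => _; last by rewrite !mul0rz.
rewrite -!mulrzA setUA inversionsUl // inversionsUr //; congr (_ *~ _).
by rewrite -!exprD -addnA [in LHS]addnC.
Qed.

Lemma wedge1l u : wedge (ext_mon set0) u = u.
Proof.
rewrite {2}[u]ext_expand [in LHS](ext_expand u) wedge_sumr; apply: eq_bigr => S _.
rewrite wedgeMzr wedge_monE -setI_eq0 set0I eqxx set0U [inversions _ _]eq_card0 //.
by move=> p; rewrite !inE.
Qed.

Lemma wedge1r u : wedge u (ext_mon set0) = u.
Proof.
rewrite {2}[u]ext_expand [in LHS](ext_expand u) wedge_suml; apply: eq_bigr => S _.
rewrite wedgeMzl wedge_monE -setI_eq0 setI0 eqxx setU0 [inversions _ _]eq_card0 //.
by move=> p; rewrite !inE andbF.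
Qed.

Lemma inversions1 s T : inversions [set s] T = #|[set t in T | (t < s)%O]|.
Proof.
have inj : injective (pair s : E -> E * E) by move=> a b [].
rewrite -(card_imset _ inj).
apply: eq_card => -[a b]; rewrite !inE /=; apply/and3P/imsetP => /=.
  by case=> /eqP -> bT bs; exists b; rewrite ?inE ?bT.
by case=> t; rewrite inE => /andP[tT ts] [-> ->]; rewrite eqxx.
Qed.

(** The sign for moving [s] from the front of s /\ e_T to its place. Only elements t < s are
    counted, so adding [s] to [T] or removing it changes nothing. *)
Definition sgn s T : int := (-1) ^+ inversions [set s] T.

Lemma sgn_sq s T : sgn s T * sgn s T = 1.
Proof. by rewrite -expr2 sqrr_sign. Qed.

Lemma sgnD1 s T : sgn s (T :\ s) = sgn s T.
Proof.
rewrite /sgn !inversions1; congr (_ ^+ _); apply: eq_card => t; rewrite !inE.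
by case: eqP => [->|]; rewrite ?ltxx ?andbF.
Qed.

Lemma sgnU1 s T : sgn s (s |: T) = sgn s T.
Proof.
rewrite /sgn !inversions1; congr (_ ^+ _); apply: eq_card => t; rewrite !inE.
by case: eqP => [->|]; rewrite ?ltxx ?andbF.
Qed.

Lemma sgn_insert s t T : t \notin T ->
  sgn s (t |: T) = (if (t < s)%O then - sgn s T else sgn s T).
Proof.
move=> tT; rewrite /sgn inversionsUr ?disjoints1 // exprD inversions1.
case: ifP => ts; last first.
  rewrite [#|_|]eq_card0 ?expr0 ?mul1r // => x; rewrite !inE.
  by case: eqP => [->|//]; rewrite ts.
rewrite [#|_|](_ : _ = 1%N) ?expr1 ?mulN1r //.
by rewrite -(cards1 t); apply: eq_card => x; rewrite !inE; case: eqP => [->|].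
Qed.

(** Inserting [s] and deleting [t] anticommute. On the left the pair s, t contributes one inversion,
    in the first factor if t < s and in the second if s < t; on the right it contributes none. *)
Lemma sgn_swap s t T : s != t -> s \notin T -> t \in T ->
  sgn s T * sgn t (s |: T) = - (sgn t T * sgn s (T :\ t)).
Proof.
move=> st sT tT; rewrite sgn_insert // -{1}(setD1K tT) sgn_insert ?setD11 //.
by case: (ltgtP t s) st => // _ _; rewrite ?mulNr ?mulrN mulrC.
Qed.

Lemma wedge_ext_sumE A u S :
  wedge (ext_sum A) u S = \sum_(s in A | s \in S) sgn s S * u (S :\ s).
Proof.
rewrite wedge_suml ext_sumE big_mkcondr; apply: eq_bigr => s _.
rewrite [in LHS](ext_expand u) wedge_sumr ext_sumE.
transitivity (\sum_(T | (s \in S) && (T == S :\ s)) sgn s S * u T).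
  rewrite [RHS]big_mkcond; apply: eq_bigr => T _.
  rewrite wedgeMzr wedge_monE ext_MzE disjoints1.
  case: ifPn => sT; last first.
    rewrite ffunE mul0r; case: andP => // -[_ /eqP TE].
    by rewrite TE setD11 in sT.
  rewrite ext_MzE ffunE; case: andP => [[sS /eqP ->]|nT].
    by rewrite setD1K // eqxx mul1r -[_ ^+ _]/(sgn s _) sgnD1.
  case: eqP => [SE|_]; last by rewrite !mul0r.
  by case: nT; rewrite SE setU11 setU1K.
case: ifP => sS; last by rewrite big_pred0.
by rewrite big_pred1_eq.
Qed.

Lemma wedge_sumC A B : wedge (ext_sum A) (ext_sum B) = - wedge (ext_sum B) (ext_sum A).
Proof.
rewrite !wedge_suml -sumrN; under eq_bigr do rewrite wedge_sumr.
under [RHS]eq_bigr do rewrite wedge_sumr -sumrN.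
rewrite exchange_big; apply: eq_bigr => s _; apply: eq_bigr => t _.
rewrite !wedge_monE !disjoints1 !inE eq_sym; case: eqVneq => [|st]; first by rewrite oppr0.
rewrite setUC -mulrNz; congr (_ *~ _).
rewrite -[LHS]/(sgn _ _) -[X in - X]/(sgn _ _) -[[set s]]setU0 -[[set t]]setU0.
rewrite !sgn_insert ?inE // /sgn !inversions1 ![#|_|]eq_card0 => [|x|x]; rewrite ?inE //.
by case: ltgtP st => //; rewrite opprK.
Qed.

(** Anticommutation only says that twice the square is 0, but the coefficients are integers. *)
Lemma wedge_sum_sq A : wedge (ext_sum A) (ext_sum A) = 0.
Proof.
apply/ffunP => S; have := congr1 (ext_coef S) (wedge_sumC A A).
rewrite /ext_coef !ffunE => /eqP; rewrite -addr_eq0 -mulr2n mulrn_eq0 /=.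
by move/eqP.
Qed.

Lemma ext_sumD A B : B \subset A -> ext_sum (A :\: B) = ext_sum A - ext_sum B.
Proof.
move=> BA; apply/eqP; rewrite eq_sym subr_eq /ext_sum (big_setID B) addrC /=.
by move/setIidPr: BA => ->.
Qed.

End ExteriorTheory.

(** * Flats, covers and bases of minors *)

Section MatroidTheory.
Variables (E : finType) (M : matroid E).
Implicit Types (A B F G H K L N X Y : {set E}) (s t : E).

Lemma rankU A B : (rank M (A :|: B) <= rank M A + #|B|)%N.
Proof.
move: {2}#|B| (erefl #|B|) => n; elim: n B => [|n IH] B cB.
  by rewrite (cards0_eq cB) setU0 cards0 addn0.
have /card_gt0P[s sB] : (0 < #|B|)%N by rewrite cB.
rewrite -(setD1K sB) setUCA (leq_trans (rankU1 _ _ _)) //.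
rewrite cardsU1 setD11 addnS ltnS IH //.
by move: cB; rewrite (cardsD1 s) sB => -[].
Qed.

Lemma flat_sub_cl F A : flat M F -> A \subset F -> cl M A \subset F.
Proof. by move=> /eqP {2}<-; apply: clS. Qed.

Lemma flat_eq_rank X Y : flat M X -> X \subset Y -> (rank M Y <= rank M X)%N -> X = Y.
Proof.
move=> fX XY; rewrite leqNgt => r; apply/eqP; apply: contraNT r => nXY.
by apply: (flat_rank_lt fX); rewrite properEneq nXY.
Qed.

Lemma flatI F G : flat M F -> flat M G -> flat M (F :&: G).
Proof.
move=> fF fG; rewrite /flat eqEsubset sub_cl andbT subsetI.
by rewrite !flat_sub_cl ?subsetIl ?subsetIr.
Qed.

Lemma minor_basis_sub F G B : minor_basis M F G B -> F \subset G.
Proof. by case/and4P. Qed.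

Lemma minor_basis_subD F G B : minor_basis M F G B -> B \subset G :\: F.
Proof. by case/and4P. Qed.

Lemma minor_basis_subr F G B : minor_basis M F G B -> B \subset G.
Proof. by move/minor_basis_subD/subset_trans; apply; apply: subsetDl. Qed.

Lemma minor_basis_cl F G B : minor_basis M F G B -> cl M (F :|: B) = G.
Proof. by case/and4P => _ _ _ /eqP. Qed.

Lemma minor_basis_flat F G B : minor_basis M F G B -> flat M G.
Proof. by move/minor_basis_cl <-; apply: flat_cl. Qed.

Lemma minor_basis_rank F G B : minor_basis M F G B ->
  rank M G = (rank M F + #|B|)%N.
Proof. by case/and4P => FG _ /eqP -> _; rewrite subnKC ?rankS. Qed.

Lemma minor_basis0 F : flat M F -> minor_basis M F F set0.
Proof.
by move=> fF; rewrite /minor_basis subxx sub0set cards0 subnn setU0 eqxx.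
Qed.

Lemma minor_basisxx F B : minor_basis M F F B -> B = set0.
Proof.
move=> bB; apply: cards0_eq; have /eqP := minor_basis_rank bB.
by rewrite -[X in X == _]addn0 eqn_add2l => /eqP.
Qed.

Lemma rank_insert F s : flat M F -> s \notin F ->
  rank M (s |: F) = (rank M F).+1.
Proof.
move=> /eqP fF; rewrite -{1}fF inE => sF; apply/eqP; rewrite eqn_leq rankU1.
by rewrite ltn_neqAle eq_sym sF rankS // subsetUr.
Qed.

Lemma covers_flatl K L : covers M K L -> flat M K.
Proof. by case/and4P. Qed.

Lemma covers_flatr K L : covers M K L -> flat M L.
Proof. by case/and4P. Qed.

Lemma covers_sub K L : covers M K L -> K \subset L.
Proof. by case/and4P => _ _ /proper_sub. Qed.

Lemma covers_asym K L : covers M K L -> covers M L K = false.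
Proof.
move=> KL; apply/negP => LK; have := covers_rank KL.
by rewrite (covers_rank LK) => /eqP; rewrite -[X in X == _]addn0 -addn2 eqn_add2l.
Qed.

Lemma covers_eq_cl L X t : covers M L X -> t \in X -> t \notin L ->
  cl M (t |: L) = X.
Proof.
move=> LX tX tL; apply: flat_eq_rank; first exact: flat_cl.
  by rewrite flat_sub_cl ?(covers_flatr LX) // subUset sub1set tX covers_sub.
by rewrite rank_cl rank_insert ?(covers_flatl LX) // (covers_rank LX).
Qed.

Lemma covers_cl L K t : flat M L -> flat M K -> L \subset K ->
  t \in K -> t \notin L -> covers M L (cl M (t |: L)).
Proof.
move=> fL fK LK tK tL; apply: rank_covers => //; first exact: flat_cl.
  exact: subset_trans (subsetUr _ _) (sub_cl _ _).
by rewrite rank_cl rank_insert.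
Qed.

Lemma minor_basis1 L K s : covers M L K -> s \in K :\: L ->
  minor_basis M L K [set s].
Proof.
move=> LK /setDP[sK sL]; rewrite /minor_basis (covers_sub LK) sub1set inE sK sL.
by rewrite cards1 (covers_rank LK) subSnn eqxx setUC (covers_eq_cl LK) ?eqxx.
Qed.

Lemma minor_basis_insert F L K s B : covers M L K -> s \in K :\: L ->
  minor_basis M F L B -> minor_basis M F K (s |: B).
Proof. by move=> LK sKL; apply: minor_basisU; apply: minor_basis1. Qed.

Lemma minor_basis_notin F L K s B : s \in K :\: L ->
  minor_basis M F L B -> s \notin B.
Proof.
by move=> /setDP[_ sL] /minor_basis_subr /subsetP BL; apply: contra sL => /BL.
Qed.

(** Deleting [t] lowers the rank of [F :|: B] by at most one, while the flat [X], being proper in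
    [K], has smaller rank than [K]. Hence [X] is the closure of [F :|: B :\ t], and a hyperplane of
    [K]. *)
Lemma minor_basis_del F K X B t : minor_basis M F K B -> t \in B ->
  flat M X -> F \subset X -> X \subset K -> B :\ t \subset X -> t \notin X ->
  minor_basis M F X (B :\ t) /\ covers M X K.
Proof.
move=> bB tB fX FX XK BX tX; have rK := minor_basis_rank bB.
have tK : t \in K by apply: (subsetP (minor_basis_subr bB)).
have ltXK : (rank M X < rank M K)%N.
  by apply: flat_rank_lt => //; apply/properP; split=> //; exists t.
have leFX : F :|: B :\ t \subset X by rewrite subUset FX.
have rF : (rank M K <= (rank M (F :|: B :\ t)).+1)%N.
  by rewrite -(minor_basis_cl bB) rank_cl -{1}(setD1K tB) setUCA rankU1.
have eX : rank M X = rank M (F :|: B :\ t).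
  apply/eqP; rewrite eqn_leq (rankS M leFX) andbT -ltnS.
  exact: leq_trans ltXK rF.
have rX : rank M K = (rank M X).+1 by apply/eqP; rewrite eqn_leq ltXK eX rF.
split; last exact: rank_covers (minor_basis_flat bB) _ _.
rewrite /minor_basis FX /=; apply/and3P; split.
- rewrite subsetD BX (disjointWl (subD1set _ _)) //.
  by move: (minor_basis_subD bB); rewrite subsetD => /andP[].
- by move: rX; rewrite rK (cardsD1 t) tB addnS => -[<-]; rewrite addKn.
- by apply/eqP/flat_eq_rank; rewrite ?flat_cl ?flat_sub_cl // rank_cl eX.
Qed.

(** [F :\ j] is the intersection of the flats [F] and [K :\ j]. Consequently a coloop of [K] avoids
    every cyclic flat inside [K]. *)
Lemma coloop_sub F K j : flat M F -> F \subset K -> coloop M K j -> j \in F ->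
  coloop M F j.
Proof.
move=> fF FK /andP[_ fL] jF; rewrite /coloop jF.
have -> : F :\ j = F :&: (K :\ j).
  apply/setP => x; rewrite !inE; case: eqP => //= _; first by rewrite andbF.
  by case xF: (x \in F) => //=; rewrite (subsetP FK).
exact: flatI.
Qed.

End MatroidTheory.

(** * The action of flag paths: adjointness, (FS), and the meet relation for equal ends *)

Section FlagAction.
Variables (d : Order.disp_t) (E : finOrderType d) (M : matroid E).
Implicit Types (A B F G H K L N S T X : {set E}) (s t : E) (u v w : ext E).
Implicit Types (p q : seq {set E}).

Definition supported F G u := forall B, u B != 0 -> minor_basis M F G B.

Lemma supported0 F G : supported F G 0.
Proof. by move=> B; rewrite ffunE eqxx. Qed.

Lemma supportedB F G u v : supported F G u -> supported F G v ->
  supported F G (u - v).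
Proof.
move=> su sv B; apply: contraNT => nB; rewrite !ffunE.
have /eqP -> : u B == 0 by apply: contraNT nB; apply: su.
have /eqP -> : v B == 0 by apply: contraNT nB; apply: sv.
by rewrite subrr.
Qed.

Lemma supported_mon F G B : minor_basis M F G B -> supported F G (ext_mon B).
Proof. by move=> bB C; rewrite ffunE; case: (eqVneq C B) => [->|]. Qed.

(* The adjoint of the wedge product with the sum of K \ L, as a map from the
   F-component at K to the F-component at L: the test on minor_basis is the
   orthogonal projection onto the latter. *)
Definition contr F L K u : ext E :=
  [ffun B : {set E} => if minor_basis M F L B
    then \sum_(s in K :\: L) sgn s B * u (s |: B) else 0].

Lemma contr_is_zmod_morphism F L K : zmod_morphism (contr F L K).
Proof.
move=> u v; apply/ffunP => B; rewrite !ffunE; case: ifP; last by rewrite subr0.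
by move=> _; rewrite -sumrB; apply: eq_bigr => s _; rewrite !ffunE mulrBr.
Qed.

(** Adjacency is not tested; the second branch is meant for [K] covered by [L]. *)
Definition step F K L : ext E -> ext E :=
  if covers M L K then wedge (ext_sum (K :\: L)) else contr F K L.

Lemma step_is_zmod_morphism F K L : zmod_morphism (step F K L).
Proof.
rewrite /step; case: ifP => _; last exact: contr_is_zmod_morphism.
exact: wedge_is_zmod_morphism.
Qed.

HB.instance Definition _ F K L :=
  GRing.isZmodMorphism.Build (ext E) (ext E) (step F K L)
    (step_is_zmod_morphism F K L).

(* A path (K_1, ..., K_l) acts from the component at K_l to that at K_1, so that
   concatenation of paths is composition. *)
Fixpoint act F p (u : ext E) : ext E :=
  if p is K :: q then (if q is L :: _ then step F K L (act F q u) else u) else u.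

Lemma act_is_zmod_morphism F p : zmod_morphism (act F p).
Proof.
move=> u v; elim: p => [|K [|L q] IH] //.
by rewrite -[LHS]/(step F K L (act F (L :: q) (u - v))) IH raddfB.
Qed.

HB.instance Definition _ F p :=
  GRing.isZmodMorphism.Build (ext E) (ext E) (act F p)
    (act_is_zmod_morphism F p).

Lemma act0 F p : act F p 0 = 0.
Proof. exact: raddf0. Qed.

Lemma actMz F p u (c : int) : act F p (u *~ c) = act F p u *~ c.
Proof. exact: raddfMz. Qed.

Lemma act_cons F K L q u : act F (K :: L :: q) u = step F K L (act F (L :: q) u).
Proof. by []. Qed.

Lemma act_cat F p K q u :
  act F (p ++ K :: q) u = act F (rcons p K) (act F (K :: q) u).
Proof.
elim: p => [|H [|L p] IH] //.
by rewrite -[LHS]/(step F H L (act F ((L :: p) ++ K :: q) u)) IH.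
Qed.

Lemma step_supported F K L u : adjacent M K L -> supported F L u ->
  supported F K (step F K L u).
Proof.
rewrite /step => KL su B; case: ifP => LK; last first.
  by rewrite ffunE; case: ifP => //; rewrite eqxx.
rewrite wedge_ext_sumE; apply: contraNT => nB; apply/eqP/big1 => s /andP[sKL sB].
have [/eqP ->|/su bB] := boolP (u (B :\ s) == 0); first by rewrite mulr0.
by rewrite -(setD1K sB) (minor_basis_insert LK sKL bB) in nB.
Qed.

Lemma act_supported F p u : is_flagpath M p -> supported F (last set0 p) u ->
  supported F (head set0 p) (act F p u).
Proof.
elim: p => [|K [|L q] IH] //= /and3P[_ KL pq] su.
apply: step_supported => //; apply: IH => //=; rewrite pq andbT.
by case/orP: KL => /and4P[].
Qed.

Definition eform u v : int := \sum_S u S * v S.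

Lemma eformC u v : eform u v = eform v u.
Proof. by apply: eq_bigr => S _; rewrite mulrC. Qed.

Lemma eform_monr u B : eform u (ext_mon B) = u B.
Proof.
rewrite /eform (bigD1 B) //= ffunE eqxx mulr1 big1 ?addr0 // => S SB.
by rewrite ffunE (negPf SB) mulr0.
Qed.

Lemma supported_eq0 F G u : supported F G u ->
  (forall v, supported F G v -> eform u v = 0) -> u = 0.
Proof.
move=> su u0; apply/ffunP => B; rewrite ffunE; apply/eqP/negPn/negP => uB.
by move: (uB); rewrite -eform_monr u0 ?eqxx //; apply: supported_mon (su _ uB).
Qed.

(** Pairs (s, B) correspond to sets [s |: B] with a marked s. The support of [u] excludes the pairs
    with s in B, and it makes the projection inside [contr] harmless. *)
Lemma wedge_contr F L K u v : supported F L u ->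
  eform (wedge (ext_sum (K :\: L)) u) v = eform u (contr F L K v).
Proof.
move=> su; rewrite /eform.
under eq_bigr do rewrite wedge_ext_sumE mulr_suml big_mkcondr.
rewrite exchange_big /=.
transitivity (\sum_(B : {set E}) \sum_(s in K :\: L) u B * (sgn s B * v (s |: B))).
  rewrite [RHS]exchange_big; apply: eq_bigr => s sKL; rewrite -big_mkcond.
  rewrite (reindex_onto (fun B => s |: B) (fun S => S :\ s)) /= => [|S sS]; last first.
    by rewrite setD1K.
  rewrite big_mkcond; apply: eq_bigr => B _; rewrite setU11 /=.
  case: eqP => [->|nB]; first by rewrite sgnU1 mulrCA mulrA.
  have [->|/su bB] := eqVneq (u B) 0; first by rewrite mul0r.
  by case: nB; rewrite setU1K // (minor_basis_notin sKL bB).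
apply: eq_bigr => B _; rewrite ffunE -mulr_sumr.
by have [->|/su ->] := eqVneq (u B) 0; first by rewrite !mul0r.
Qed.

Lemma step_adj F K L u v : adjacent M K L -> supported F L u -> supported F K v ->
  eform (step F K L u) v = eform u (step F L K v).
Proof.
rewrite /step => KL su sv; case: ifP KL => LK; rewrite /adjacent LK ?orbT ?orbF => KL.
  by rewrite (covers_asym LK); apply: wedge_contr.
by rewrite KL eformC -wedge_contr // eformC.
Qed.

Lemma adjacentC K L : adjacent M K L = adjacent M L K.
Proof. exact: orbC. Qed.

Lemma is_flagpath_cat p K q :
  is_flagpath M (p ++ K :: q) = is_flagpath M (rcons p K) && is_flagpath M (K :: q).
Proof.
case: p => [|H p] /=; first by rewrite andbT; case: (flat M K).
rewrite cat_path rcons_path /= -!andbA; congr (_ && _).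
case: (path _ H p) => //=; have [fK|nK] := boolP (flat M K).
  by [].
rewrite /= andbF; apply/negP => /andP[] /orP[] /and4P[]; by rewrite ?(negPf nK).
Qed.

Lemma is_flagpath_rev p : is_flagpath M (rev p) = is_flagpath M p.
Proof.
elim: p => // K [|L q] // IH; rewrite rev_cons -[K :: L :: q]/([:: K] ++ L :: q).
rewrite is_flagpath_cat -IH rev_cons -!cats1 -catA cat1s is_flagpath_cat.
rewrite cats1 -rev_cons andbC cats1 -rev_cons; congr (_ && _).
rewrite /= !andbT adjacentC.
case: (boolP (adjacent M K L)) => [/orP[] /and4P[-> ->] //|_].
by rewrite !andbF.
Qed.

Lemma act_adj F p u v : is_flagpath M p -> supported F (last set0 p) u ->
  supported F (head set0 p) v -> eform (act F p u) v = eform u (act F (rev p) v).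
Proof.
elim: p v => [|K [|L q] IH] v // pP su sv.
have /andP[fK KL] : is_flagpath M [:: K; L] && is_flagpath M (L :: q).
  by rewrite -(is_flagpath_cat [:: K]).
have aKL : adjacent M K L by move: fK => /= /andP[_ /andP[]].
rewrite act_cons step_adj //; last by apply: (act_supported KL).
rewrite IH //; last by apply: step_supported; rewrite // adjacentC.
by rewrite !rev_cons -[rcons (rcons _ _) K]cats1 cat_rcons act_cat.
Qed.

(** The sets [X :\: L] partition [K :\: L]: an element s lies in the one with X the closure of
    [s |: L]. *)
Lemma cover_sum (V : nmodType) L K (f : E -> V) : flat M L -> flat M K ->
  L \subset K -> rank M K = (rank M L).+2 ->
  \sum_(X | covers M L X && covers M X K) \sum_(s in X :\: L) f s =
  \sum_(s in K :\: L) f s.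
Proof.
move=> fL fK LK rK; rewrite (exchange_big_dep (mem (K :\: L))) /=; last first.
  move=> X s /andP[_ XK] /setDP[sX sL]; rewrite inE sL /=.
  exact: (subsetP (covers_sub XK)).
apply: eq_bigr => s /setDP[sK sL].
rewrite (big_pred1 (cl M (s |: L))) // => X; apply/andP/eqP.
  by case=> /andP[LX _] /setDP[sX _]; rewrite (covers_eq_cl LX sX sL).
move=> ->; have LX := covers_cl fL fK LK sK sL.
rewrite LX /= inE sL; split; last by apply: (subsetP (sub_cl _ _)); rewrite setU11.
apply: rank_covers => //; first exact: flat_cl.
  by apply: flat_sub_cl => //; rewrite subUset sub1set sK.
by rewrite rK (covers_rank LX).
Qed.

(** In each term [K :\: X] may be enlarged to [K :\: L], because the sum of [X :\: L] has square 0.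
    By [cover_sum] the total is then the square of the sum of [K :\: L]. *)
Lemma wedge_cover_sum L K u : flat M L -> flat M K ->
  L \subset K -> rank M K = (rank M L).+2 ->
  \sum_(X | covers M L X && covers M X K)
    wedge (ext_sum (K :\: X)) (wedge (ext_sum (X :\: L)) u) = 0.
Proof.
move=> fL fK LK rK.
transitivity (\sum_(X | covers M L X && covers M X K)
    wedge (ext_sum (K :\: L)) (wedge (ext_sum (X :\: L)) u)).
  apply: eq_bigr => X /andP[LX XK]; rewrite !wedgeA; congr (wedge _ _).
  have -> : K :\: X = (K :\: L) :\: (X :\: L).
    apply/setP => s; rewrite !inE negb_and negbK.
    by have := subsetP (covers_sub LX) s; case: (s \in L) => [->|] //=; rewrite ?andbF.
  by rewrite (ext_sumD (setSD L (covers_sub XK))) wedgeBl wedge_sum_sq subr0.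
rewrite -wedge_sumr -wedge_suml /ext_sum cover_sum // wedgeA wedge_sum_sq.
exact: wedge0l.
Qed.

Lemma act_FS_down F L K u : flat M L -> flat M K ->
  L \subset K -> rank M K = (rank M L).+2 ->
  \sum_(X | covers M L X && covers M X K) act F [:: K; X; L] u = 0.
Proof.
move=> fL fK LK rK; rewrite -[RHS](wedge_cover_sum u fL fK LK rK).
by apply: eq_bigr => X /andP[LX XK]; rewrite /= /step LX XK.
Qed.

Lemma supported_sum F G (I : finType) (P : pred I) (f : I -> ext E) :
  (forall i, P i -> supported F G (f i)) -> supported F G (\sum_(i | P i) f i).
Proof.
move=> sf B; rewrite ext_sumE; apply: contraNT => nB; apply/eqP/big1 => i Pi.
by apply/eqP; apply: contraNT nB; apply: sf.
Qed.

Lemma eform_suml (I : finType) (P : pred I) (f : I -> ext E) v :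
  eform (\sum_(i | P i) f i) v = \sum_(i | P i) eform (f i) v.
Proof.
rewrite /eform exchange_big; apply: eq_bigr => S _.
by rewrite ext_sumE mulr_suml.
Qed.

Lemma eform_sumr (I : finType) (P : pred I) (f : I -> ext E) v :
  eform v (\sum_(i | P i) f i) = \sum_(i | P i) eform v (f i).
Proof. by rewrite eformC eform_suml; apply: eq_bigr => i _; apply: eformC. Qed.

(** Adjoint to [act_FS_down]; the pairing detects zero among supported elements. *)
Lemma act_FS_up F L K u : flat M L -> flat M K ->
  L \subset K -> rank M K = (rank M L).+2 -> supported F K u ->
  \sum_(X | covers M L X && covers M X K) act F [:: L; X; K] u = 0.
Proof.
move=> fL fK LK rK su.
have pX X : covers M L X && covers M X K -> is_flagpath M [:: L; X; K].
  by case/andP=> LX XK; rewrite /= /adjacent LX XK fL.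
apply: (@supported_eq0 F L) => [|v sv].
  by apply: supported_sum => X /pX pX'; apply: (act_supported pX').
rewrite eform_suml; under eq_bigr => X /pX pX' do rewrite (act_adj pX') //.
by rewrite -eform_sumr act_FS_down // /eform big1 // => S _; rewrite ffunE mulr0.
Qed.

(** As B lies in K, the only element of [s |: B] outside K is s. So what was inserted is removed
    again with the same sign, once for every s in [L :\: K]. *)
Lemma act_meet_eq F K L u : covers M K L -> supported F K u ->
  act F [:: K; L; K] u = u *+ #|L :\: K|.
Proof.
move=> KL su; apply/ffunP => B.
rewrite /= /step (covers_asym KL) KL pmulrn ext_MzE ffunE.
case: ifP => bB; last first.
  by have [->|/su] := eqVneq (u B) 0; rewrite ?mul0r // bB.
transitivity (\sum_(s in L :\: K) u B); last by rewrite sumr_const -mulr_natr natz.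
apply: eq_bigr => s sLK; rewrite wedge_ext_sumE.
have sB := minor_basis_notin sLK bB.
rewrite (big_pred1 s) => [|t]; first by rewrite setU1K // sgnU1 mulrA sgn_sq mul1r.
case: (eqVneq t s) => [->|ts] /=; first by rewrite sLK setU11 eqxx.
rewrite (negPf ts) !inE (negPf ts) /=.
apply/negP => /andP[/andP[tK _]] /(subsetP (minor_basis_subr bB)).
by rewrite (negPf tK).
Qed.

End FlagAction.

(** * The meet relation for distinct ends, and the join relation *)

Section FlagActionRelations.
Variables (d : Order.disp_t) (E : finOrderType d) (M : matroid E).
Implicit Types (A B F G H K L N S T X : {set E}) (s t : E) (u v w : ext E).

Lemma setU1_D1 s t B : s != t -> (s |: B) :\ t = s |: B :\ t.
Proof.
move=> st; apply/setP => x; rewrite !inE.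
by case: (eqVneq x s) => [->|]; rewrite ?st.
Qed.

(** Both paths exchange an element t of B for some s, in opposite orders, so [sgn_swap] gives
    opposite signs. A nonzero term forces s to lie in K' and [B :\ t] to be a basis of the minor at
    K :&: K', which is then covered by K; if it is not, every term is 0. *)
Lemma act_meet_neq F K K' L u : covers M K L -> covers M K' L -> K != K' ->
  supported M F K' u ->
  act M F [:: K; L; K'] u =
    if covers M (K :&: K') K then - act M F [:: K; K :&: K'; K'] u else 0.
Proof.
move=> KL K'L nKK' su; set N := K :&: K'.
have fK := covers_flatl KL; have fK' := covers_flatl K'L.
have fN : flat M N by apply: flatI.
have s1 : supported M F K (act M F [:: K; L; K'] u).
  apply: (@act_supported _ _ _ F [:: K; L; K']) => //=.
  by rewrite fK /adjacent KL K'L orbT.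
have s2 : supported M F K
    (if covers M N K then - act M F [:: K; N; K'] u else 0).
  case: ifP => NK; last exact: supported0.
  rewrite -[- _]sub0r; apply: supportedB; first exact: supported0.
  apply: (@act_supported _ _ _ F [:: K; N; K']) => //.
  exact: meet_flagpath KL K'L NK.
apply/ffunP => B; have [bB|nB] := boolP (minor_basis M F K B); last first.
  transitivity (0 : int); [|symmetry]; apply/eqP; apply: contraNT nB.
    by move=> /s1.
  by move=> /s2.
have BK := minor_basis_subr bB; have FK := minor_basis_sub bB.
(* This disposes of the terms with t = s, where [u] is evaluated at [B] itself. *)
have uB : u B = 0.
  apply/eqP; apply: contraNT nKK' => /su /minor_basis_cl <-.
  by rewrite (minor_basis_cl bB).
have key s t : s \in L :\: K -> t \in B :\: K' -> u (s |: B :\ t) != 0 ->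
    [/\ s \in K', minor_basis M F N (B :\ t) & covers M N K].
  move=> /setDP[sL sK] /setDP[tB tK'] /su b'.
  have := minor_basis_subr b'; rewrite subUset sub1set => /andP[sK' BtK'].
  have [||||bN NK] := minor_basis_del bB tB fN.
  - by rewrite subsetI FK (minor_basis_sub b').
  - exact: subsetIl.
  - by rewrite subsetI BtK' (subset_trans (subD1set _ _)).
  - by rewrite inE (negPf tK') andbF.
  by split.
transitivity (- \sum_(s in L :\: K) \sum_(t in B :\: K')
   sgn t B * (sgn s (B :\ t) * u (s |: B :\ t))).
  rewrite /= /step (covers_asym KL) K'L ffunE bB -sumrN; apply: eq_bigr => s sLK.
  have [sL sK] := setDP sLK.
  have sB : s \notin B by apply: contra sK; apply: (subsetP BK).
  rewrite wedge_ext_sumE mulr_sumr -sumrN big_mkcond [RHS]big_mkcond.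
  apply: eq_bigr => t _; case: (eqVneq t s) => [->|ts].
    by rewrite setU1K // uB !mulr0 if_same inE (negPf sB) andbF.
  rewrite !inE (negPf ts) /= -andbA.
  have [tB|] := boolP (t \in B); last by rewrite !andbF.
  rewrite (subsetP (covers_sub KL)) ?(subsetP BK) // !andbT.
  case: ifP => // _; rewrite setU1_D1; last by rewrite eq_sym.
  by rewrite mulrA sgn_swap // 1?eq_sym // mulNr mulrA.
case: ifP => NK; last first.
  rewrite ffunE big1 ?oppr0 // => s sLK; rewrite big1 // => t tB.
  have [->|/(key _ _ sLK tB)[_ _]] := eqVneq (u (s |: B :\ t)) 0.
    by rewrite !mulr0.
  by rewrite NK.
have NK' := covers_meet KL K'L NK.
rewrite /= /step NK (covers_asym NK') [RHS]ffunE wedge_ext_sumE; congr (- _).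
rewrite exchange_big /=; apply: eq_big => [t|t tB].
  rewrite !inE; case tB: (t \in B); rewrite ?andbF ?andbT //.
  by rewrite (subsetP BK t tB) andbT.
rewrite -mulr_sumr ffunE; congr (_ * _).
case: ifPn => bN; last first.
  rewrite big1 // => s sLK; have [->|/(key _ _ sLK tB)[_]] := eqVneq (u (s |: B :\ t)) 0.
    by rewrite !mulr0.
  by rewrite (negPf bN).
(* The left sum is over [L :\: K], the right one over [K' :\: N], which is [K' :\: K]; by [key] the
   other s in [L :\: K] contribute 0. *)
rewrite big_mkcond [RHS]big_mkcond; apply: eq_bigr => s _.
rewrite !inE; have [sK|sK] := boolP (s \in K); first by rewrite /= andNb.
rewrite /=; case: ifP => sL; case: ifP => sK' //.
  have sLK : s \in L :\: K by rewrite inE sK.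
  have [->|/(key _ _ sLK tB)[]] := eqVneq (u (s |: B :\ t)) 0; first by rewrite mulr0.
  by rewrite sK'.
by rewrite (subsetP (covers_sub K'L)) in sL.
Qed.

(** As [F] is cyclic it does not contain the coloop [j], so every basis of the minor of K over F
    does. The two steps take [j] out of such a monomial and put it back, with equal signs. *)
Lemma act_join F K j u : cyclic_flat M F -> flat M K -> coloop M K j ->
  supported M F K u -> act M F [:: K; K :\ j; K] u = u.
Proof.
move=> /andP[fF cF] fK jK su; have LK := covers_coloop fK jK.
have /andP[jinK fL] := jK.
have s1 : supported M F K (act M F [:: K; K :\ j; K] u).
  by apply: (@act_supported _ _ _ F [:: K; K :\ j; K]) => //; apply: coloop_flagpath.
apply/ffunP => B; have [bB|nB] := boolP (minor_basis M F K B); last first.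
  transitivity (0 : int); [|symmetry]; apply/eqP; apply: contraNT nB.
    by move=> /s1.
  by move=> /su.
have FK := minor_basis_sub bB.
have jF : j \notin F.
  by apply: contra cF => jF; apply/existsP; exists j; apply: coloop_sub jK jF.
have FL : F \subset K :\ j by rewrite subsetD1 FK.
have jB : j \in B.
  apply/negPn/negP => njB; have := minor_basis_cl bB.
  have /(flat_sub_cl fL) : F :|: B \subset K :\ j.
    by rewrite subUset FL subsetD1 (minor_basis_subr bB).
  by move=> sub eq; move: (subsetP sub j); rewrite eq jinK setD11 => /(_ isT).
have [||bL _] := minor_basis_del bB jB fL FL (subD1set _ _).
- by rewrite setSD // (minor_basis_subr bB).
- by rewrite setD11.
have KD : K :\: (K :\ j) = [set j].
  by rewrite setDDr setDv set0U; apply/setIidPr; rewrite sub1set.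
rewrite /= /step LK (covers_asym LK) wedge_ext_sumE KD.
rewrite (big_pred1 j) => [|t]; last by rewrite !inE; case: eqP => //= ->.
by rewrite ffunE bL KD big_set1 setD1K // sgnD1 mulrA sgn_sq mul1r.
Qed.

End FlagActionRelations.

(** * Flags and their forms: duality and spanning *)

Section Flags.
Variables (d : Order.disp_t) (E : finOrderType d) (M : matroid E).
Implicit Types (A B F G H K L N S T X : {set E}) (a s t : E) (u v w : ext E).
Implicit Types (p q r : seq {set E}).

(* K :: p is a maximal chain of flats from K down to N. *)
Definition flag N K p : bool :=
  path (fun L H => covers M H L) K p && (last K p == N).

(** The parameter [set0] is an arbitrary choice: along a flag only the wedge branch of [step] is
    taken, and it does not depend on the base, see [act_flag]. *)
Definition flag_form p : ext E := act M set0 p (ext_mon set0).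

(** Compatibility with the descending half of (FS) in any context. One notion covers coefficients of
    flag forms, elements of S(M), and elements of reversed paths. *)
Definition FS_invariant (V : zmodType) (g : seq {set E} -> V) : Prop :=
  forall p K L q, flat M K -> flat M L -> L \subset K ->
    rank M K = (rank M L).+2 ->
    \sum_(X | covers M L X && covers M X K) g (p ++ [:: K, X, L & q]) = 0.

Lemma flag_cons N K H p : flag N K (H :: p) = covers M H K && flag N H p.
Proof. by rewrite /flag /= andbA. Qed.

Lemma flag_sub N K p : flag N K p -> N \subset K.
Proof.
elim: p K => [|H p IH] K; first by case/andP => _ /eqP <-.
by rewrite flag_cons => /andP[/covers_sub HK /IH /subset_trans]; apply.
Qed.

Lemma flag_nil N p : flag N N p -> p = [::].
Proof.
case: p => // H p; rewrite flag_cons => /andP[HN /flag_sub NH].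
by case/and4P: HN => _ _ /properP[_ [x /(subsetP NH) ->]].
Qed.

Lemma flag_path N K p : flat M K -> flag N K p -> is_flagpath M (K :: p).
Proof.
move=> fK /andP[pK _]; rewrite /= fK; apply: sub_path pK => L H HL.
by rewrite /adjacent HL orbT.
Qed.

Lemma flag_last N K p : flag N K p -> last set0 (K :: p) = N.
Proof. by case/andP => _ /eqP. Qed.

Lemma flag_form_cons K H p : covers M H K ->
  flag_form [:: K, H & p] = wedge (ext_sum (K :\: H)) (flag_form (H :: p)).
Proof. by move=> HK; rewrite /flag_form act_cons /step HK. Qed.

Lemma act_flag F N K p u : flag N K p ->
  act M F (K :: p) u = wedge (flag_form (K :: p)) u.
Proof.
elim: p K => [|H p IH] K; first by rewrite wedge1l.
rewrite flag_cons => /andP[HK /IH eq].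
by rewrite act_cons /step HK flag_form_cons // -wedgeA -eq.
Qed.

Lemma flag_form_supported N K p : flat M N -> flat M K -> flag N K p ->
  supported M N K (flag_form (K :: p)).
Proof.
move=> fN fK pNK; rewrite -[flag_form _]wedge1r -(act_flag N _ pNK).
apply: (@act_supported _ _ _ N (K :: p)); first exact: flag_path pNK.
by rewrite (flag_last pNK); apply/supported_mon/minor_basis0.
Qed.

(** Split [K :\: N] into [K :\: H] and [H :\: N]. The first part repeats the leading factor of the
    form; the second anticommutes past that factor and meets the induction hypothesis. This puts
    flag forms into checkU. *)
Lemma flag_form_wedge0 N K p : flag N K p ->
  wedge (ext_sum (K :\: N)) (flag_form (K :: p)) = 0.
Proof.
elim: p K => [|H p IH] K.
  by case/andP => _ /eqP <-; rewrite /= setDv /ext_sum big_set0 wedge0l.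
rewrite flag_cons => /andP[HK pH]; rewrite flag_form_cons //.
have -> : ext_sum (K :\: N) = ext_sum (K :\: H) + ext_sum (H :\: N).
  have -> : K :\: H = (K :\: N) :\: (H :\: N).
    apply/setP => s; rewrite !inE negb_and negbK.
    by have := subsetP (flag_sub pH) s; case: (s \in N) => [->|] //=; rewrite ?andbF.
  by rewrite (ext_sumD (setSD N (covers_sub HK))) subrK.
rewrite wedgeDl wedgeA wedge_sum_sq wedge0l add0r wedgeA wedge_sumC.
by rewrite -sub0r wedgeBl wedge0l -wedgeA IH // wedge0r subr0.
Qed.

Lemma FS_invariant_act F u : FS_invariant (fun p => act M F p u).
Proof.
move=> p K L q fK fL LK rK.
transitivity (act M F (rcons p K) (\sum_(X | covers M L X && covers M X K)
    act M F [:: K; X; L] (act M F (L :: q) u))).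
  by rewrite raddf_sum; apply: eq_bigr => X _; rewrite act_cat.
by rewrite act_FS_down // raddf0.
Qed.

Lemma FS_invariant_cons (V : zmodType) (g : seq {set E} -> V) K :
  FS_invariant g -> FS_invariant (fun p => g (K :: p)).
Proof. by move=> Ig p; apply: (Ig (K :: p)). Qed.

(* Through (FS), a flag whose hyperplane H contains a is rewritten in terms of
   the flags that replace H by the other flats between K and the next flat. *)
Lemma FS_invariant_eq0 (V : zmodType) (g : seq {set E} -> V) N K a :
  FS_invariant g -> a \in K :\: N ->
  (forall H p, flag N K (H :: p) -> a \notin H -> g [:: K, H & p] = 0) ->
  forall p, flag N K p -> g (K :: p) = 0.
Proof.
move=> Ig /setDP[aK aN] g0 p; elim: p K g Ig aK g0 => [|H p IH] K g Ig aK g0.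
  by case/andP => _ /eqP KN; rewrite -KN aK in aN.
move=> pK; have [aH|/(g0 _ _ pK)//] := boolP (a \in H).
move: (pK); rewrite flag_cons => /andP[HK pH].
apply: (IH H (fun q => g (K :: q))) => // [|G q]; first exact: FS_invariant_cons.
rewrite flag_cons => /andP[GH qG] aG.
have rK : rank M K = (rank M G).+2 by rewrite (covers_rank HK) (covers_rank GH).
have := Ig [::] K G q (covers_flatr HK) (covers_flatl GH)
  (subset_trans (covers_sub GH) (covers_sub HK)) rK.
rewrite (bigD1 H) ?GH //= big1 ?addr0 // => X /andP[/andP[GX XK] XH].
apply: g0; first by rewrite !flag_cons XK GX.
apply: contra XH => aX.
by rewrite -(covers_eq_cl GX aX aG) (covers_eq_cl GH aH aG).
Qed.

(** Bases at H avoid a, so a can only come from the leading factor, and what remains must be a basis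
    at H, which determines H. Thus these coefficients separate the hyperplanes that avoid a. *)
Lemma flag_form_insert N K H H' p a B : flat M N -> covers M H K ->
  flag N H p -> a \in K -> a \notin H -> a \notin H' -> minor_basis M N H' B ->
  flag_form [:: K, H & p] (a |: B) =
    if H' == H then sgn a B * flag_form (H :: p) B else 0.
Proof.
move=> fN HK pH aK aH aH' bB.
have sH := flag_form_supported fN (covers_flatl HK) pH.
have aB : a \notin B by apply: contra aH' => /(subsetP (minor_basis_subr bB)).
rewrite flag_form_cons // wedge_ext_sumE (bigD1 a) /=; last first.
  by rewrite inE aH aK setU11.
rewrite setU1K // sgnU1 big1 ?addr0 => [|s /andP[_ sa]].
  case: eqP => // H'H; have [->|/sH /minor_basis_cl HB] := eqVneq (flag_form (H :: p) B) 0.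
    by rewrite mulr0.
  by case: H'H; rewrite -HB (minor_basis_cl bB).
have [->|/sH /minor_basis_subr /subsetP/(_ a)] :=
  eqVneq (flag_form (H :: p) ((a |: B) :\ s)) 0.
  by rewrite mulr0.
by rewrite !inE eqxx eq_sym sa (negPf aH) => /(_ isT).
Qed.

(** For an entry (p, c, B) of [l], the flag p is one of a set of generators modulo (FS), and c times
    the coefficient at B is its coordinate. The list is chosen before [V] and [g]; the induction
    passes from [g] to [g (K :: _)] and needs the same list for both. *)
Lemma flag_dual N K : flat M N -> flat M K -> N \subset K ->
  exists l : seq (seq {set E} * int * {set E}),
    (forall x, x \in l -> flag N K x.1.1 /\ minor_basis M N K x.2) /\
    forall (V : zmodType) (g : seq {set E} -> V), FS_invariant g ->
    forall p, flag N K p ->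
      g (K :: p) = \sum_(x <- l)
        g (K :: x.1.1) *~ (x.1.2 * flag_form (K :: p) x.2).
Proof.
move=> fN; have [n] := ubnP #|K|; elim: n K => // n IH K leK fK NK.
have [KN|nKN] := eqVneq N K.
  exists [:: ([::], 1, set0)]; rewrite -KN in fK *; split.
    by move=> x; rewrite inE => /eqP ->; rewrite /flag /= eqxx minor_basis0.
  move=> V g _ p /flag_nil ->.
  by rewrite big_seq1 /= ffunE eqxx mulr1.
have [a aK aN] : exists2 a, a \in K & a \notin N.
  by apply/subsetPn; apply: contra nKN => KN; rewrite eqEsubset NK.
have aKN : a \in K :\: N by rewrite inE aN.
pose P H := [&& covers M H K, N \subset H & a \notin H].
have /choice[lf lfP] : forall H, exists l : seq (seq {set E} * int * {set E}), P H ->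
    (forall x, x \in l -> flag N H x.1.1 /\ minor_basis M N H x.2) /\
    forall (V : zmodType) (g : seq {set E} -> V), FS_invariant g ->
    forall p, flag N H p ->
      g (H :: p) = \sum_(x <- l)
        g (H :: x.1.1) *~ (x.1.2 * flag_form (H :: p) x.2).
  move=> H; have [/and3P[HK NH aH]|_] := boolP (P H); last by exists [::].
  have [|l lP] := IH H _ (covers_flatl HK) NH; last by exists l.
  rewrite -ltnS; apply: leq_trans leK; rewrite ltnS; apply: proper_card.
  by case/and4P: HK.
(* The factor [sgn a x.2] cancels the sign of [flag_form_insert]. *)
pose ins H (x : seq {set E} * int * {set E}) :=
  (H :: x.1.1, x.1.2 * sgn a x.2, a |: x.2).
exists (flatten [seq [seq ins H x | x <- lf H] | H <- enum P]); split.
  move=> z /flatten_mapP[H]; rewrite mem_enum => PH /mapP[x xl ->{z}].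
  have /and3P[HK NH aH] := PH; have [/(_ _ xl)[fx bx] _] := lfP _ PH.
  rewrite flag_cons HK fx /= (minor_basis_insert HK _ bx) //.
  by rewrite inE aH.
(* The difference of the two sides is itself [FS_invariant], since flag forms are. So it has to
   vanish only on flags whose first hyperplane avoids a, where [flag_form_insert] singles out that
   hyperplane. *)
move=> V g Ig p pK; apply/eqP; rewrite -subr_eq0; apply/eqP; move: p pK.
apply: (FS_invariant_eq0 (g := fun p => g p - \sum_(x <- _)
   g (K :: x.1.1) *~ (x.1.2 * flag_form p x.2)) _ aKN) => [p G L q fG fL LG rG|].
  rewrite sumrB Ig // sub0r exchange_big big1 ?oppr0 //= => x _.
  rewrite -raddf_sum -mulr_sumr -ext_sumE.
  by rewrite (FS_invariant_act set0 (ext_mon set0) p q fG fL LG rG) ffunE mulr0.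
move=> H p; rewrite flag_cons => /andP[HK pH] aH.
have PH : P H by rewrite /P HK (flag_sub pH).
have [_ /(_ V _ (FS_invariant_cons K Ig) p pH) ->] := lfP _ PH.
rewrite big_flatten big_map big_enum (bigD1 H) //= [X in _ - (_ + X)]big1 ?addr0.
  apply/eqP; rewrite subr_eq0; apply/eqP; rewrite big_map big_seq [RHS]big_seq.
  apply: eq_bigr => x xl; congr (_ *~ _).
  have [/(_ _ xl)[fx bx] _] := lfP _ PH.
  rewrite (flag_form_insert fN HK pH aK aH aH bx) eqxx.
  by rewrite -mulrA [sgn a _ * (_ * _)]mulrA sgn_sq mul1r.
move=> H' /andP[PH' nH]; rewrite big_map big_seq big1 // => x xl.
have [/(_ _ xl)[_ bx] _] := lfP _ PH'; have /and3P[_ _ aH'] := PH'.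
by rewrite (flag_form_insert fN HK pH aK aH aH' bx) (negPf nH) mulr0 mulr0z.
Qed.

(* With a in K \ N, u is the wedge product of the sum of K \ N with the
   contraction y of u by a. The condition on u forces the part of y that is
   supported on a flat H, which does not contain a, to be annihilated by the
   sum of H \ N. *)
Lemma flag_span N K u : flat M N -> flat M K -> N \subset K ->
  supported M N K u -> wedge (ext_sum (K :\: N)) u = 0 ->
  forall P : ext E -> Prop, P 0 -> (forall v w, P v -> P w -> P (v - w)) ->
  (forall p, flag N K p -> P (flag_form (K :: p))) -> P u.
Proof.
move=> fN; have [n] := ubnP #|K|; elim: n K u => // n IH K u leK fK NK su bu P P0 PB Pf.
have [KN|nKN] := eqVneq N K.
  have -> : u = flag_form [:: K] *~ u set0.
    apply/ffunP => B; rewrite ext_MzE ffunE; case: (eqVneq B set0) => [->|nB].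
      by rewrite mul1r.
    rewrite mul0r; apply/eqP; apply: contraNT nB => /su.
    by rewrite KN => /minor_basisxx ->.
  by apply: additive_pred_Mz => //; apply: Pf; rewrite /flag /= KN.
have [a aK aN] : exists2 a, a \in K & a \notin N.
  by apply/subsetPn; apply: contra nKN => KN; rewrite eqEsubset NK.
pose Q H := [&& covers M H K, N \subset H & a \notin H].
pose y H : ext E := [ffun B : {set E} =>
  if minor_basis M N H B then sgn a B * u (a |: B) else 0].
have sy H : supported M N H (y H).
  by move=> B; rewrite ffunE; case: ifP => //; rewrite eqxx.
have sw s S : a \notin S -> s \in S ->
    sgn s S * (sgn a (S :\ s) * u (a |: S :\ s)) =
    - (sgn a S * (sgn s (a |: S) * u (a |: S :\ s))).
  move=> aS sS; have sa : a != s by apply: contraNneq aS => ->.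
  by rewrite [in RHS]mulrA sgn_swap // mulNr opprK mulrA.
(* The coefficient at [a |: S] of the equation [bu], with the term s = a moved to the other side. *)
have uE S : a \notin S -> \sum_(s in K :\: N | s \in S)
    sgn s (a |: S) * u (a |: S :\ s) = - (sgn a S * u S).
  move=> aS; have := congr1 (ext_coef (a |: S)) bu.
  rewrite /ext_coef wedge_ext_sumE ffunE (bigD1 a) /=; last first.
    by rewrite !inE aN aK eqxx.
  rewrite setU1K // sgnU1 => /eqP; rewrite addrC addr_eq0 => /eqP <-.
  apply: eq_big => [s|s /andP[_ sS]]; last first.
    by rewrite setU1_D1 //; apply: contraNneq aS => ->.
  rewrite !inE; case: (eqVneq s a) => [->|_] /=.
    by rewrite (negPf aS) !andbF.
  by rewrite andbT.
have by0 H : Q H -> wedge (ext_sum (H :\: N)) (y H) = 0.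
  case/and3P=> HK NH aH; apply/ffunP => S; rewrite [RHS]ffunE wedge_ext_sumE.
  have [SH|nSH] := boolP (S \subset H :\: N); last first.
    apply: big1 => s /andP[sH sS]; rewrite ffunE.
    case: ifP; rewrite ?mulr0 // => /minor_basis_subD sub.
    by case/negP: nSH; rewrite -(setD1K sS) subUset sub1set sH.
  have aS : a \notin S by apply: contra aH => /(subsetP SH)/setDP[].
  (* [S] lies in the flat [H], so the closure of [N :|: S] misses a and cannot be [K]. *)
  have uS : u S = 0.
    apply/eqP; apply: contraNT aH => /su /minor_basis_cl KE.
    have NSH : N :|: S \subset H.
      by rewrite subUset NH (subset_trans SH) // subsetDl.
    by apply: (subsetP (flat_sub_cl (covers_flatl HK) NSH)); rewrite KE.
  transitivity (- \sum_(s in H :\: N | s \in S)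
      sgn a S * (sgn s (a |: S) * u (a |: S :\ s))).
    rewrite -sumrN; apply: eq_bigr => s /andP[sH sS]; rewrite -sw // ffunE.
    case: ifPn => // nb; have [->|/su b] := eqVneq (u (a |: S :\ s)) 0.
      by rewrite !mulr0.
    have a' : a \notin S :\ s by rewrite !inE (negPf aS) andbF.
    have [||] := minor_basis_del b (setU11 _ _) (covers_flatl HK) NH (covers_sub HK).
    - rewrite setU1K // (subset_trans (subD1set _ _)) // (subset_trans SH) //.
      exact: subsetDl.
    - by [].
    - by rewrite setU1K // (negPf nb).
  rewrite -mulr_sumr (eq_bigl (fun s => (s \in K :\: N) && (s \in S))) => [|s].
    by rewrite uE // uS !(mulr0, oppr0).
  case sS: (s \in S); rewrite ?andbF // !andbT (subsetP SH _ sS).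
  have /setDP[sH sN] := subsetP SH _ sS.
  by rewrite inE sN (subsetP (covers_sub HK)).
(* If [a |: B] is a basis at [K], then [B] is a basis at exactly one hyperplane, the closure of
   [N :|: B]. So the pieces [y H] add up to the contraction by a without overlap. *)
have ysum B : (\sum_(H | Q H) y H) B = if a \in B then 0 else sgn a B * u (a |: B).
  rewrite ext_sumE; case: ifPn => aB.
    apply: big1 => H /and3P[_ _ aH]; rewrite ffunE; case: ifP => // /minor_basis_subr.
    by move/subsetP/(_ a aB); rewrite (negPf aH).
  have [u0|/su b] := eqVneq (u (a |: B)) 0.
    by rewrite u0 mulr0 big1 // => H _; rewrite ffunE u0 mulr0 if_same.
  pose X := cl M (N :|: B).
  have BX : N :|: B \subset X by apply: sub_cl.
  move: (BX); rewrite subUset => /andP[NX BX'].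
  have aX : a \notin X.
    apply/negP => aX; have := minor_basis_rank b; rewrite cardsU1 aB => rK.
    have : (rank M K <= rank M X)%N.
      rewrite -(minor_basis_cl b) rank_cl rankS // setUCA subUset sub1set aX.
      exact: BX.
    rewrite rank_cl rK addnCA add1n => /leq_trans/(_ (rankU M N B)).
    by rewrite ltnn.
  have XK : X \subset K.
    apply: flat_sub_cl => //; rewrite subUset NK.
    exact: subset_trans (subsetUr _ _) (minor_basis_subr b).
  have [|//|bX cX] := minor_basis_del b (setU11 _ _) (flat_cl M _) NX XK.
    by rewrite setU1K.
  rewrite setU1K // in bX.
  have QX : Q X by rewrite /Q cX NX.
  rewrite (bigD1 X) //= ffunE bX big1 ?addr0 // => H /andP[_ HX].
  by rewrite ffunE; case: ifP => // /minor_basis_cl HE; rewrite -HE eqxx in HX.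
(* Using [K :\: H] in place of [K :\: N] changes a term by the wedge of [H :\: N] with [y H], which
   is 0 by [by0]. *)
have -> : u = \sum_(H | Q H) wedge (ext_sum (K :\: H)) (y H).
  transitivity (\sum_(H | Q H) wedge (ext_sum (K :\: N)) (y H)); last first.
    apply: eq_bigr => H QH; have /and3P[HK NH aH] := QH.
    have -> : K :\: H = (K :\: N) :\: (H :\: N).
      apply/setP => s; rewrite !inE negb_and negbK.
      by have := subsetP NH s; case: (s \in N) => [->|] //=; rewrite ?andbF.
    by rewrite (ext_sumD (setSD N (covers_sub HK))) wedgeBl by0 // subr0.
  rewrite -wedge_sumr; apply/ffunP => S; rewrite wedge_ext_sumE.
  have [aS|aS] := boolP (a \in S).
    rewrite (bigD1 a) /=; last by rewrite inE aN aK aS.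
    rewrite ysum setD11 setD1K // sgnD1 mulrA sgn_sq mul1r big1 ?addr0 //.
    by move=> s /andP[_ sa]; rewrite ysum !inE eq_sym sa aS mulr0.
  transitivity (- \sum_(s in K :\: N | s \in S)
      sgn a S * (sgn s (a |: S) * u (a |: S :\ s))).
    by rewrite -mulr_sumr uE // mulrN opprK mulrA sgn_sq mul1r.
  rewrite -sumrN; apply: eq_bigr => s /andP[_ sS].
  by rewrite ysum !inE (negPf aS) andbF sw.
apply: additive_pred_sum => // H QH; have /and3P[HK NH aH] := QH.
have leH : (#|H| < n)%N.
  rewrite -ltnS; apply: leq_trans leK; rewrite ltnS; apply: proper_card.
  by case/and4P: HK.
(* The induction hypothesis is applied to [P] composed with the wedge by [K :\: H], which turns flag
   forms from [H] into flag forms from [K]. *)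
apply: (IH H (y H) leH (covers_flatl HK) NH (sy H) (by0 H QH)
  (fun v => P (wedge (ext_sum (K :\: H)) v))) => [|v w Pv Pw|p pH].
- by rewrite wedge0r.
- by rewrite wedgeBr; apply: PB.
- by rewrite -flag_form_cons //; apply: Pf; rewrite flag_cons HK.
Qed.

End Flags.

(** * The flag algebra: reducing paths to down-up form *)

Section FlagAlgebraTheory.
Variables (d : Order.disp_t) (E : finOrderType d) (M : matroid E).
Implicit Types (F G H K L N X : {set E}) (j : E) (p q : seq {set E}).

Lemma path_elt_notin p : ~~ is_flagpath M p -> path_elt M p = 0.
Proof. by move=> np; rewrite /path_elt insubN. Qed.

(** No condition on the paths: if a factor is not a flag path, neither is the concatenation, and
    both sides are 0. *)
Lemma path_elt_cat p K q :
  path_elt M (p ++ K :: q) = path_elt M (rcons p K) * path_elt M (K :: q).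
Proof.
have [/andP[pP qP]|] := boolP (is_flagpath M (rcons p K) && is_flagpath M (K :: q)).
  rewrite -[rcons p K]/(val (FlagPath pP)) -[K :: q]/(val (FlagPath qP)) !path_eltE.
  rewrite [RHS]pathalg_mulU /path_cat /= last_rcons eqxx cat_rcons.
  by [].
move=> npq; rewrite path_elt_notin ?is_flagpath_cat //.
by case/nandP: npq => n; rewrite (path_elt_notin n) ?mul0r ?mulr0.
Qed.

Local Notation "<[ s ]>" := (flag_elt M s).

Lemma flag_elt_cat p K q : <[ p ++ K :: q ]> = <[ rcons p K ]> * <[ K :: q ]>.
Proof. by rewrite /flag_elt path_elt_cat -[RHS]rmorphM. Qed.

Lemma flag_elt_ext x y : ideal_gen (@flag_rel E M) (x - y) ->
  quot_pi (ideal_gen (@flag_rel E M)) x = quot_pi _ y.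
Proof. by move/quot_piP. Qed.

Lemma flag_elt_FS_down L K : flat M L -> flat M K -> L \subset K ->
  rank M K = (rank M L).+2 ->
  \sum_(X | covers M L X && covers M X K) <[ [:: K; X; L] ]> = 0.
Proof.
move=> fL fK LK rK; rewrite -[LHS]raddf_sum -[RHS](rmorph0 (quot_pi _)).
apply: flag_elt_ext; rewrite subr0; apply: Gen_in; apply: Rel_FS_down => //.
rewrite properEneq LK andbT; apply/eqP => LKe.
by move/eqP: rK; rewrite LKe -addn2 -[X in X == _]addn0 eqn_add2l.
Qed.

Lemma flag_elt_FS_up L K : flat M L -> flat M K -> L \subset K ->
  rank M K = (rank M L).+2 ->
  \sum_(X | covers M L X && covers M X K) <[ [:: L; X; K] ]> = 0.
Proof.
move=> fL fK LK rK; rewrite -[LHS]raddf_sum -[RHS](rmorph0 (quot_pi _)).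
apply: flag_elt_ext; rewrite subr0; apply: Gen_in; apply: Rel_FS_up => //.
rewrite properEneq LK andbT; apply/eqP => LKe.
by move/eqP: rK; rewrite LKe -addn2 -[X in X == _]addn0 eqn_add2l.
Qed.

Lemma flag_elt_meet K K' L : covers M K L -> covers M K' L ->
  <[ [:: K; L; K'] ]> =
    if K == K' then <[ [:: K] ]> *+ #|L :\: K|
    else if covers M (K :&: K') K then - <[ [:: K; K :&: K'; K'] ]> else 0.
Proof.
move=> KL K'L; transitivity (quot_pi (ideal_gen (@flag_rel E M)) (meet_rhs M K K' L)).
  by apply: flag_elt_ext; apply: Gen_in; apply: Rel_meet.
rewrite /meet_rhs; case: ifP => _; first by rewrite raddfMn.
by case: ifP => _; rewrite ?raddfN ?raddf0.
Qed.

Lemma FS_invariant_down : FS_invariant M (flag_elt M).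
Proof.
move=> p K L q fK fL LK rK.
transitivity (<[ rcons p K ]> * (\sum_(X | covers M L X && covers M X K)
    <[ [:: K; X; L] ]>) * <[ L :: q ]>).
  rewrite mulr_sumr mulr_suml; apply: eq_bigr => X _.
  by rewrite flag_elt_cat -mulrA -(flag_elt_cat [:: K; X]).
by rewrite flag_elt_FS_down // mulr0 mul0r.
Qed.

Lemma FS_invariant_up : FS_invariant M (fun p => <[ rev p ]>).
Proof.
move=> p K L q fK fL LK rK.
transitivity (<[ rcons (rev q) L ]> * (\sum_(X | covers M L X && covers M X K)
    <[ [:: L; X; K] ]>) * <[ K :: rev p ]>).
  rewrite mulr_sumr mulr_suml; apply: eq_bigr => X _.
  rewrite -mulrA -(flag_elt_cat [:: L; X]) -flag_elt_cat rev_cat !rev_cons.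
  by rewrite -!cats1 -!catA.
by rewrite flag_elt_FS_up // mulr0 mul0r.
Qed.

Local Notation I := (ideal_gen (@join_rel E M)).

(** The normal form modulo I, as an inductive predicate: the effect of one more step on the left is
    found by induction on it. *)
Inductive downup K K' : flag_alg M -> Prop :=
| DU_ideal z : I z -> downup K K' z
| DU_sub x y : downup K K' x -> downup K K' y -> downup K K' (x - y)
| DU_flags N p q : cyclic_flat M N -> flag M N K p -> flag M N K' q ->
    downup K K' (<[ K :: p ]> * <[ rev (K' :: q) ]>).

Lemma downup0 K K' : downup K K' 0.
Proof. exact/DU_ideal/ideal_mem0. Qed.

Lemma downupN K K' x : downup K K' x -> downup K K' (- x).
Proof. by rewrite -sub0r; apply/DU_sub/downup0. Qed.

Lemma downupD K K' x y : downup K K' x -> downup K K' y -> downup K K' (x + y).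
Proof. by rewrite -[y in x + y]opprK => dx /downupN; apply: DU_sub. Qed.

Lemma downupMn K K' x n : downup K K' x -> downup K K' (x *+ n).
Proof.
move=> dx; elim: n => [|n IH]; first exact: downup0.
by rewrite mulrS; apply: downupD.
Qed.

Lemma flag_elt_mul1 N K p : flag M N K p ->
  <[ K :: p ]> = <[ K :: p ]> * <[ [:: N] ]>.
Proof.
move=> /andP[_ /eqP <-]; rewrite (lastI K p) -[RHS]flag_elt_cat cats1.
by [].
Qed.

Lemma rev_flag N K q : flag M N K q -> exists r, rev (K :: q) = N :: r.
Proof.
move=> /andP[_ /eqP <-]; rewrite (lastI K q) rev_rcons.
by exists (rev (belast K q)).
Qed.

Lemma flag_rcons N H K p : flag M N K p -> covers M H N -> flag M H K (rcons p H).
Proof.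
by case/andP => pK /eqP lp HN; rewrite /flag rcons_path last_rcons pK lp HN /=.
Qed.

Lemma flag_elt_down_rcons N H K p : flag M N K p ->
  <[ K :: rcons p H ]> = <[ K :: p ]> * <[ [:: N; H] ]>.
Proof.
case/andP => _ /eqP <-; rewrite -rcons_cons (lastI K p) -flag_elt_cat.
by rewrite -!cats1 -catA.
Qed.

Lemma flag_elt_up_rcons N H K q : flag M N K q ->
  <[ rev (K :: rcons q H) ]> = <[ [:: H; N] ]> * <[ rev (K :: q) ]>.
Proof.
move=> /rev_flag[r rE]; rewrite -rcons_cons rev_rcons rE.
by rewrite -(flag_elt_cat [:: H]).
Qed.

(* If j is a coloop of the bottom N, the join relation (N) = (N > N \ j < N)
   lowers the bottom to N \ j. *)
Lemma downup_flags N K K' p q : flat M N -> flag M N K p -> flag M N K' q ->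
  downup K K' (<[ K :: p ]> * <[ rev (K' :: q) ]>).
Proof.
have [n] := ubnP #|N|; elim: n N p q => // n IH N p q leN fN pK qK.
have [cN|] := boolP (cyclic_flat M N); first exact: DU_flags cN pK qK.
rewrite /cyclic_flat fN negbK => /existsP[j jN].
have HN := covers_coloop fN jN.
rewrite -[X in downup _ _ X](subrK (<[ K :: rcons p (N :\ j) ]> *
  <[ rev (K' :: rcons q (N :\ j)) ]>)); apply: downupD.
  have -> : <[ K :: p ]> * <[ rev (K' :: q) ]> -
      <[ K :: rcons p (N :\ j) ]> * <[ rev (K' :: rcons q (N :\ j)) ]> =
    <[ K :: p ]> * (<[ [:: N] ]> - <[ [:: N; N :\ j; N] ]>) * <[ rev (K' :: q) ]>.
    rewrite mulrBr mulrBl -(flag_elt_mul1 pK); congr (_ - _).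
    rewrite (flag_elt_cat [:: N]) (flag_elt_down_rcons _ pK).
    by rewrite (flag_elt_up_rcons _ qK) !mulrA.
  apply/DU_ideal/ideal_memMr/ideal_memMl; rewrite -opprB.
  exact/ideal_memN/Gen_in/Rel_join.
apply: (IH (N :\ j)); last by apply: flag_rcons qK HN.
- by move: leN; rewrite (cardsD1 j); case/andP: jN => -> _; rewrite add1n ltnS.
- exact: covers_flatl HN.
- exact: flag_rcons pK HN.
Qed.

Lemma downup_stepdown H K K' z : covers M K H -> downup K K' z ->
  downup H K' (<[ [:: H; K] ]> * z).
Proof.
move=> KH; elim=> {z} [z Iz|x y _ IHx _ IHy|N p q cN pK qK].
- exact/DU_ideal/ideal_memMl.
- by rewrite mulrBr; exact: DU_sub IHx IHy.
- rewrite mulrA -(flag_elt_cat [:: H]); apply: DU_flags cN _ qK.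
  by rewrite flag_cons KH.
Qed.

(** The meet relation turns H < K > G into minus H > H :&: G < G, or a multiple of (H), or 0; so the
    upward step travels down the descending flag. If it arrives at the bottom, H becomes the new
    bottom and [downup_flags] replaces it by a cyclic one. *)
Lemma downup_stepup H K K' z : covers M H K -> downup K K' z ->
  downup H K' (<[ [:: H; K] ]> * z).
Proof.
move=> HK; elim=> {z} [z Iz|x y _ IHx _ IHy|N p q cN pK qK].
- exact/DU_ideal/ideal_memMl.
- by rewrite mulrBr; exact: DU_sub IHx IHy.
have fN : flat M N by case/andP: cN.
elim: p K H HK pK => [|G p IH] K H HK pK.
  case/andP: pK => _ /eqP /= KN; rewrite KN in HK *.
  have [r rE] := rev_flag qK.
  rewrite mulrA -(flag_elt_cat [:: H] N [::]) -(flag_elt_up_rcons _ qK).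
  have fH := covers_flatl HK.
  have qH := flag_rcons qK HK.
  have [r' rE'] := rev_flag qH.
  rewrite rE' -[H :: r']/([::] ++ H :: r') flag_elt_cat -[rcons _ _]/[:: H] -rE'.
  by apply: downup_flags fH _ qH; rewrite /flag /=.
move: pK; rewrite flag_cons => /andP[GK pG].
rewrite -[[:: K, G & p]]/([:: K] ++ G :: p) flag_elt_cat -mulrA.
rewrite mulrA -(flag_elt_cat [:: H] K [:: G]) [_ ++ _]/= flag_elt_meet //.
case: eqP => [->|_].
  rewrite mulrnAl mulrA -(flag_elt_cat [::] G p); apply: downupMn.
  exact: DU_flags cN pG qK.
case: ifP => HG; last by rewrite mul0r; apply: downup0.
rewrite mulNr; apply: downupN.
rewrite -[[:: H; _; G]]/([:: H] ++ (H :&: G) :: [:: G]) flag_elt_cat -mulrA.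
apply: downup_stepdown => //; apply: IH => //.
exact: covers_meet HK GK HG.
Qed.

Lemma downup_path K p : is_flagpath M (K :: p) ->
  downup K (last K p) (<[ K :: p ]>).
Proof.
elim: p K => [|H p IH] K /=.
  rewrite andbT => fK.
  rewrite -[[:: K]]/([::] ++ [:: K]) flag_elt_cat.
  by apply: (@downup_flags K _ _ [::] [::]); rewrite // /flag /=.
case/and3P=> fK KH pH.
have /IH dH : is_flagpath M (H :: p).
  by rewrite /= pH andbT; case/orP: KH => /and4P[].
rewrite -[[:: K, H & p]]/([:: K] ++ H :: p) flag_elt_cat.
by case/orP: KH => KH; [exact: downup_stepup|exact: downup_stepdown].
Qed.

(* A term (c, N, p, q) stands for c times the path that descends from K to N
   along p and ascends from N to K' along q. *)
Definition downup_sum K K' (l : seq (int * {set E} * seq {set E} * seq {set E})) :=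
  \sum_(x <- l) (<[ K :: x.1.2 ]> * <[ rev (K' :: x.2) ]>) *~ x.1.1.1.

Definition downup_list K K' (l : seq (int * {set E} * seq {set E} * seq {set E})) :=
  forall x, x \in l -> [/\ cyclic_flat M x.1.1.2, flag M x.1.1.2 K x.1.2
                         & flag M x.1.1.2 K' x.2].

(** An explicit list is wanted because independence is proved by striking out terms. *)
Lemma downup_sumP K K' z : downup K K' z ->
  exists2 l, downup_list K K' l & I (z - downup_sum K K' l).
Proof.
elim=> {z} [z Iz|x y _ [l lP lI] _ [m mP mI]|N p q cN pK qK].
- by exists [::] => //; rewrite /downup_sum big_nil subr0.
- exists (l ++ [seq (- x.1.1.1, x.1.1.2, x.1.2, x.2) | x <- m]).
    move=> z; rewrite mem_cat => /orP[/lP //|/mapP[w wm ->]].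
    exact: mP wm.
  have -> : downup_sum K K' (l ++ [seq (- x.1.1.1, x.1.1.2, x.1.2, x.2) | x <- m]) =
      downup_sum K K' l - downup_sum K K' m.
    rewrite /downup_sum big_cat big_map /= -sumrN; congr (_ + _).
    by apply: eq_bigr => z _; rewrite mulrNz.
  have -> : x - y - (downup_sum K K' l - downup_sum K K' m) =
      (x - downup_sum K K' l) - (y - downup_sum K K' m).
    by rewrite !opprD !opprK addrACA.
  exact: ideal_memB.
- exists [:: (1, N, p, q)]; first by move=> x; rewrite inE => /eqP ->.
  have -> : downup_sum K K' [:: (1, N, p, q)] = <[ K :: p ]> * <[ rev (K' :: q) ]>.
    by rewrite /downup_sum big_seq1 mulr1z.
  by rewrite subrr; apply: ideal_mem0.
Qed.

End FlagAlgebraTheory.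

(** * The path algebra acting on families *)

Section PathAction.
Variables (d : Order.disp_t) (E : finOrderType d) (M : matroid E).
Implicit Types (F G H K L N X : {set E}) (j : E) (p q : seq {set E}).
Implicit Types (f g h : pathalg M) (u v : ext E).

(** A summand for every subset of E, flat or not; [fam_supported F] cuts this down to the bases of
    minors over [F]. *)
Definition ext_family := {ffun {set E} -> ext E}.
Implicit Types w : ext_family.

HB.instance Definition _ := GRing.Zmodule.on ext_family.

Definition fam_supported F w := forall G, supported M F G (w G).

Definition delta_fam K u : ext_family := [ffun G => if G == K then u else 0].

Definition path_act F p w : ext_family :=
  delta_fam (head set0 p) (act M F p (w (last set0 p))).

Definition alg_act F w f : ext_family :=
  \sum_(p <- msupp f) path_act F p w *~ f@_p.

Lemma delta_fam_is_zmod_morphism K : zmod_morphism (delta_fam K).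
Proof. by move=> u v; apply/ffunP => G; rewrite !ffunE; case: ifP; rewrite ?subr0. Qed.

HB.instance Definition _ K :=
  GRing.isZmodMorphism.Build (ext E) ext_family (delta_fam K)
    (delta_fam_is_zmod_morphism K).

Lemma alg_actw F w f (D : {fset flagpath M}) : (msupp f `<=` D)%fset ->
  alg_act F w f = \sum_(p <- D) path_act F p w *~ f@_p.
Proof.
move=> le; apply: big_fset_incl => // p _ /mcoeff_outdom ->.
by rewrite mulr0z.
Qed.

Lemma alg_act_is_zmod_morphism F w : zmod_morphism (alg_act F w).
Proof.
move=> f g; rewrite (alg_actw _ _ (msuppB_le f g)).
rewrite (alg_actw _ _ (fsubsetUl (msupp f) (msupp g))).
rewrite (alg_actw _ _ (fsubsetUr (msupp f) (msupp g))) -sumrB.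
by apply: eq_bigr => p _; rewrite mcoeffB mulrzBr.
Qed.

HB.instance Definition _ F w :=
  GRing.isZmodMorphism.Build (pathalg M) ext_family (alg_act F w)
    (alg_act_is_zmod_morphism F w).

Lemma alg_actU F w (p : flagpath M) :
  alg_act F w (<< p >> : pathalg M) = path_act F p w.
Proof. by rewrite /alg_act msuppU oner_eq0 big_seq_fset1 mcoeffUU. Qed.

Lemma alg_actZ F w (c : int) f : alg_act F w (c *: f) = alg_act F w f *~ c.
Proof. by rewrite -[c]intz scaler_int raddfMz intz. Qed.

Lemma alg_act_elt F w p : is_flagpath M p ->
  alg_act F w (path_elt M p) = path_act F p w.
Proof. by move=> pP; rewrite -[p]/(val (FlagPath pP)) path_eltE alg_actU. Qed.

Lemma path_act_is_zmod_morphism F p : zmod_morphism (path_act F p).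
Proof. by move=> w1 w2; rewrite /path_act !ffunE !raddfB. Qed.

HB.instance Definition _ F p :=
  GRing.isZmodMorphism.Build ext_family ext_family (path_act F p)
    (path_act_is_zmod_morphism F p).

Definition alg_act_by F f w := alg_act F w f.

Lemma alg_act_by_is_zmod_morphism F f : zmod_morphism (alg_act_by F f).
Proof.
move=> w1 w2; rewrite /alg_act_by /alg_act -sumrB; apply: eq_bigr => p _.
by rewrite raddfB mulrzBl.
Qed.

HB.instance Definition _ F f :=
  GRing.isZmodMorphism.Build ext_family ext_family (alg_act_by F f)
    (alg_act_by_is_zmod_morphism F f).

Lemma alg_act0 F f : alg_act F 0 f = 0.
Proof. exact: (raddf0 (alg_act_by F f)). Qed.

Lemma pathalg_scalerAl (c : int) f g : c *: f * g = c *: (f * g).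
Proof. exact: pathalg_mulZl. Qed.

Lemma pathalg_scalerAr (c : int) f g : f * (c *: g) = c *: (f * g).
Proof. exact: pathalg_mulZr. Qed.

Lemma pathalg_mulUU (p q : flagpath M) :
  (<< p >> : pathalg M) * << q >> = path_cat p q.
Proof. exact: pathalg_mulU. Qed.

Lemma alg_actM F w f g : alg_act F w (f * g) = alg_act F (alg_act F w g) f.
Proof.
elim/pathalg_ind: f => [|f1 f2 IH1 IH2|c p].
- by rewrite mul0r !raddf0.
- by rewrite mulrDl !raddfD /= IH1 IH2.
rewrite pathalg_scalerAl !alg_actZ alg_actU; congr (_ *~ _).
elim/pathalg_ind: g => [|g1 g2 IH1 IH2|c' q].
- by rewrite mulr0 !raddf0.
- by rewrite mulrDr !raddfD /= IH1 IH2.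
rewrite pathalg_scalerAr !alg_actZ raddfMz /=; congr (_ *~ _).
rewrite pathalg_mulUU alg_actU.
case: path_catP => [r pq rE|npq].
  rewrite alg_actU /path_act ffunE pq eqxx (path_cat_headl rE) (path_cat_lastr pq rE).
  have [L [q' qE]] : exists L q', q = L :: q' :> seq {set E}.
    by case: (q) => [[|L q'] //= _]; exists L, q'.
  have [K [p' pE]] : exists K p', p = rcons p' K :> seq {set E}.
    by case: (p) => [[|K p'] //= _]; exists (last K p'), (belast K p'); apply: lastI.
  congr delta_fam; rewrite rE; move: pq; rewrite pE qE last_rcons => -> /=.
  by rewrite cat_rcons act_cat.
by rewrite raddf0 /path_act ffunE; case: eqP npq => // _ _; rewrite !raddf0.
Qed.

Lemma path_act_supported F w (p : flagpath M) : fam_supported F w ->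
  fam_supported F (path_act F p w).
Proof.
move=> sw G; rewrite ffunE; case: eqP => [->|_]; last exact: supported0.
exact: act_supported (valP p) (sw _).
Qed.

Lemma supportedMz F G u (c : int) : supported M F G u -> supported M F G (u *~ c).
Proof.
apply: additive_pred_Mz; first exact: supported0.
by move=> x y; apply: supportedB.
Qed.

Definition fam_coef G w : ext E := w G.

Lemma fam_coef_is_zmod_morphism G : zmod_morphism (fam_coef G).
Proof. by move=> w1 w2; rewrite /fam_coef !ffunE. Qed.

HB.instance Definition _ G :=
  GRing.isZmodMorphism.Build ext_family (ext E) (fam_coef G)
    (fam_coef_is_zmod_morphism G).

Lemma alg_act_supported F w f : fam_supported F w ->
  fam_supported F (alg_act F w f).
Proof.
move=> sw G; rewrite -[alg_act F w f G]/(fam_coef G _) raddf_sum.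
apply: additive_pred_sum; first exact: supported0.
  by move=> x y; apply: supportedB.
move=> p _; rewrite raddfMz; apply: supportedMz.
exact: path_act_supported sw G.
Qed.

Lemma alg_act_idem F w (C : pred {set E}) : (forall K, C K -> flat M K) ->
  alg_act F w (\sum_(K | C K) path_elt M [:: K]) =
    [ffun G => if C G then w G else 0].
Proof.
move=> Cf; rewrite raddf_sum; apply/ffunP => G; rewrite sum_ffunE [RHS]ffunE.
have wE K : C K -> alg_act F w (path_elt M [:: K]) G = if G == K then w K else 0.
  by move=> /Cf fK; rewrite alg_act_elt /= ?fK // ffunE.
rewrite (eq_bigr _ wE); case: ifPn => CG.
  rewrite (bigD1 G) //= eqxx big1 ?addr0 // => K /andP[_ KG].
  by rewrite eq_sym (negPf KG).
by rewrite big1 // => K CK; case: eqP => // GK; rewrite GK CK in CG.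
Qed.

(** Cyclicity of [F] is what [act_join] asks for; the support condition is what ascending (FS) sums,
    the meet relation and [act_join] ask for. *)
Definition acts_trivially f := forall F w, cyclic_flat M F -> fam_supported F w ->
  alg_act F w f = 0.

Lemma acts_triviallyD f g : acts_trivially f -> acts_trivially g ->
  acts_trivially (f + g).
Proof. by move=> f0 g0 F w cF sw; rewrite raddfD /= f0 // g0 // addr0. Qed.

Lemma acts_triviallyMl g f : acts_trivially f -> acts_trivially (g * f).
Proof.
by move=> f0 F w cF sw; rewrite alg_actM f0 // alg_act0.
Qed.

Lemma acts_triviallyMr f g : acts_trivially f -> acts_trivially (f * g).
Proof.
by move=> f0 F w cF sw; rewrite alg_actM f0 //; apply: alg_act_supported.
Qed.

Lemma flag_rel_acts_trivially f : ideal_gen (@flag_rel E M) f -> acts_trivially f.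
Proof.
elim=> {f} [f fP| |f g _ IHf _ IHg|g f _ IH|f g _ IH]; last 4 first.
- by move=> F w _ _; rewrite raddf0.
- exact: acts_triviallyD.
- exact: acts_triviallyMl.
- exact: acts_triviallyMr.
move=> F w cF sw; case: fP => [L K fL fK LK rK|L K fL fK LK rK|K K' L KL K'L].
- rewrite raddf_sum -[RHS](raddf0 (delta_fam L)).
  rewrite -(act_FS_up fL fK (proper_sub LK) rK (sw K)) raddf_sum.
  apply: eq_bigr => X /andP[LX XK].
  by rewrite /= alg_act_elt //= /adjacent LX XK fL.
- rewrite raddf_sum -[RHS](raddf0 (delta_fam K)).
  rewrite -(act_FS_down F (w L) fL fK (proper_sub LK) rK) raddf_sum.
  apply: eq_bigr => X /andP[LX XK].
  by rewrite /= alg_act_elt //= /adjacent LX XK fK !orbT.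
rewrite raddfB /= alg_act_elt; last first.
  by rewrite /= /adjacent KL K'L (covers_flatl KL) orbT.
rewrite /path_act /= -[_ (step M F K L _)]/(delta_fam K (act M F [:: K; L; K'] (w K'))).
rewrite /meet_rhs; case: eqP => [<-|/eqP KK'].
  rewrite (act_meet_eq KL (sw K)) !raddfMn /= alg_act_elt; last first.
    by rewrite /= (covers_flatl KL).
  by rewrite mulNrn subrr.
rewrite (act_meet_neq KL K'L KK' (sw K')); case: ifP => NK; last first.
  by rewrite !raddf0 addr0.
rewrite !raddfN /= alg_act_elt ?opprK ?addNr ?subrr //.
exact: meet_flagpath KL K'L NK.
Qed.

Lemma quot_acts_trivially f g :
  quot_pi (ideal_gen (@flag_rel E M)) f = quot_pi _ g ->
  acts_trivially f -> acts_trivially g.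
Proof.
move/quot_piP/flag_rel_acts_trivially => fg f0 F w cF sw.
by have := fg F w cF sw; rewrite raddfB /= f0 // sub0r => /eqP; rewrite oppr_eq0 => /eqP.
Qed.

(** S(M) is not given an action of its own: an element is tested on one lift, and by [quot_trivialP]
    all other lifts then agree. *)
Definition quot_trivial (z : flag_alg M) :=
  exists2 f, quot_pi (ideal_gen (@flag_rel E M)) f = z & acts_trivially f.

Lemma join_rel_acts_trivially z : ideal_gen (@join_rel E M) z -> quot_trivial z.
Proof.
elim=> {z} [z zP| |x y _ [f <- f0] _ [g <- g0]|x y _ [f <- f0]|x y _ [f <- f0]].
- case: zP => K j fK jK; exists (path_elt M [:: K; K :\ j; K] - path_elt M [:: K]).
    by rewrite rmorphB.
  move=> F w cF sw; rewrite raddfB /= !alg_act_elt; last first.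
  + exact: coloop_flagpath.
  + by rewrite /= fK.
  rewrite /path_act -[head _ _]/K -[last _ _]/K (act_join cF fK jK (sw K)).
  by rewrite -[act _ _ _ _]/(w K) subrr.
- by exists 0; rewrite ?rmorph0 // => F w _ _; rewrite raddf0.
- by exists (f + g); rewrite ?rmorphD //; apply: acts_triviallyD.
- rewrite -[x]quot_piK; set h := repr _; exists (h * f); rewrite ?rmorphM //.
  exact: acts_triviallyMl.
- rewrite -[y]quot_piK; set h := repr _; exists (f * h); rewrite ?rmorphM //.
  exact: acts_triviallyMr.
Qed.

End PathAction.

(** * Independence of down-up paths with cyclic bottoms *)

Section Independence.
Variables (d : Order.disp_t) (E : finOrderType d) (M : matroid E).
Implicit Types (F G H K L N X B : {set E}) (p q : seq {set E}).
Implicit Types (f g h : pathalg M) (u v : ext E) (w : ext_family E).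

Local Notation I := (ideal_gen (@join_rel E M)).
Local Notation pi := (quot_pi (ideal_gen (@flag_rel E M))).

Lemma flag_flat N K p : flat M N -> flag M N K p -> flat M K.
Proof.
case: p => [|H p] fN; first by case/andP => _ /eqP /= ->.
by rewrite flag_cons => /andP[/covers_flatr].
Qed.

Lemma alg_act_down F N K p w : flat M N -> flag M N K p ->
  alg_act F w (path_elt M (K :: p)) = delta_fam K (act M F (K :: p) (w N)).
Proof.
move=> fN pK; rewrite alg_act_elt ?(flag_path _ pK) ?(flag_flat fN pK) //.
by rewrite /path_act (flag_last pK).
Qed.

Lemma alg_act_up F N K p w : flat M N -> flag M N K p ->
  alg_act F w (path_elt M (rev (K :: p))) =
    delta_fam N (act M F (rev (K :: p)) (w K)).
Proof.
move=> fN pK; rewrite alg_act_elt ?is_flagpath_rev ?(flag_path _ pK) ?(flag_flat fN pK) //.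
by rewrite /path_act rev_cons last_rcons -rev_cons; have [r ->] := rev_flag pK.
Qed.

(** The vector in the middle is supported at N over F, so it is 0 unless F is contained in N, and
    the cardinalities then give N = F. There the only basis is empty, and adjunction identifies the
    remaining scalar as a coefficient of the flag form of [K' :: q]. *)
Lemma act_downup F N K K' p q B B' : cyclic_flat M F -> flat M N ->
  flag M N K p -> flag M N K' q -> (#|N| <= #|F|)%N -> minor_basis M F K' B' ->
  act M F (K :: p) (act M F (rev (K' :: q)) (ext_mon B')) B =
    if N == F then flag_form M (K :: p) B * flag_form M (K' :: q) B' else 0.
Proof.
move=> /andP[fF _] fN pK qK leN bB'; set v := act M F (rev _) _.
have sv : supported M F N v.
  have [r rE] := rev_flag qK.
  have := @act_supported _ _ M F (rev (K' :: q)) (ext_mon B').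
  rewrite {2}rev_cons last_rcons {2}rE /=; apply; last exact: supported_mon.
  by rewrite is_flagpath_rev (flag_path _ qK) // (flag_flat fN qK).
case: eqP => [NF|nNF]; last first.
  have -> : v = 0.
    apply/ffunP => C; rewrite ffunE; apply/eqP; apply: contra_notT nNF.
    by move=> /sv /minor_basis_sub FN; apply/eqP; rewrite eq_sym eqEcard FN.
  by rewrite raddf0 ffunE.
rewrite {N}NF in fN pK qK leN sv *.
have -> : v = ext_mon set0 *~ flag_form M (K' :: q) B'.
  apply/ffunP => C; rewrite ext_MzE ffunE; have [->|nC] := eqVneq C set0.
    rewrite mul1r -(eform_monr v) -[flag_form _ _]wedge1r -(act_flag F _ qK).
    rewrite -eform_monr act_adj ?(flag_path _ qK) ?(flag_flat fN qK) //.
    - exact: eformC.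
    - by rewrite (flag_last qK); apply/supported_mon/minor_basis0.
    - exact: supported_mon.
  rewrite mul0r; apply/eqP; apply: contraNT nC => /sv /minor_basisxx ->.
  exact: eqxx.
by rewrite actMz ext_MzE (act_flag F _ pK) wedge1r.
Qed.

Lemma quot_trivialP f : quot_trivial (pi f) -> acts_trivially f.
Proof. by case=> g gf; apply: quot_acts_trivially. Qed.

(* On the component of a bottom F of maximal cardinality, only the terms with
   bottom F act nontrivially, as matrices of rank one built from flag forms. By
   flag_dual, these matrix entries determine the sum of those terms. *)
Lemma downup_independent K K' l : downup_list M K K' l ->
  quot_trivial (downup_sum M K K' l) -> downup_sum M K K' l = 0.
Proof.
have [n] := ubnP (size l); elim: n l => // n IH l ltn lP triv.
case: l => [|x0 l0] in ltn lP triv *; first by rewrite /downup_sum big_nil.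
set l := x0 :: l0 in ltn lP triv *.
pose bot (x : int * {set E} * seq {set E} * seq {set E}) := x.1.1.2.
have [F [x1 x1l x1F] Fmax] : exists2 F, exists2 x, x \in l & bot x = F &
    forall x, x \in l -> (#|bot x| <= #|F|)%N.
  pose P := fun G => has (fun x => bot x == G) l.
  have Px0 : P (bot x0) by apply/hasP; exists x0; rewrite ?mem_head.
  case: (arg_maxnP (fun G : {set E} => #|G|) Px0) => F /hasP[x xl /eqP xF] Fmax.
  exists F; first by exists x.
  by move=> z zl; apply: Fmax; apply/hasP; exists z.
have cF : cyclic_flat M F by rewrite -x1F; case: (lP _ x1l).
have fF : flat M F by case/andP: cF.
have [_ pK qK] := lP _ x1l; rewrite -/(bot x1) x1F in pK qK.
have fK := flag_flat fF pK; have fK' := flag_flat fF qK.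
pose y : pathalg M := \sum_(x <- l)
  (path_elt M (K :: x.1.2) * path_elt M (rev (K' :: x.2))) *~ x.1.1.1.
have yE : pi y = downup_sum M K K' l.
  rewrite raddf_sum; apply: eq_bigr => x _.
  by rewrite raddfMz /= rmorphM.
have key B B' : minor_basis M F K' B' ->
    \sum_(x <- l | bot x == F) x.1.1.1 *
      (flag_form M (K :: x.1.2) B * flag_form M (K' :: x.2) B') = 0.
  move=> bB'; pose w := delta_fam K' (ext_mon B').
  have sw : fam_supported M F w.
    move=> G; rewrite ffunE; case: eqP => [->|_]; last exact: supported0.
    exact: supported_mon.
  have yw : alg_act F w y = \sum_(x <- l) alg_act F w
      (path_elt M (K :: x.1.2) * path_elt M (rev (K' :: x.2))) *~ x.1.1.1.
    by rewrite [LHS]raddf_sum; apply: eq_bigr => x _; rewrite raddfMz.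
  rewrite -yE in triv; have := quot_trivialP triv cF sw; rewrite yw.
  move/(congr1 (fun w => ext_coef B (fam_coef K w))).
  rewrite [in X in _ = X]raddf0 [in X in _ = X]raddf0 raddf_sum raddf_sum => y0.
  rewrite -[RHS]y0 big_mkcond big_seq [RHS]big_seq.
  apply: eq_bigr => x xl; rewrite raddfMz raddfMz /= alg_actM.
  have [cN pN qN] := lP _ xl; have fN : flat M (bot x) by case/andP: cN.
  rewrite (alg_act_up _ _ fN qN) (alg_act_down _ _ fN pN).
  rewrite /fam_coef /ext_coef !ffunE !eqxx mulrzz.
  rewrite (act_downup B cF fN pN qN (Fmax _ xl) bB').
  by rewrite -/(bot x); case: ifP => _; rewrite ?mul0r // mulrC.
have [lp [lpP lpE]] := flag_dual fF fK (flag_sub pK).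
have [lq [lqP lqE]] := flag_dual fF fK' (flag_sub qK).
pose l1 := [seq x <- l | bot x == F]; pose l2 := [seq x <- l | bot x != F].
have sumE : downup_sum M K K' l = downup_sum M K K' l1 + downup_sum M K K' l2.
  by rewrite /downup_sum !big_filter (bigID (fun x => bot x == F)).
have l1_0 : downup_sum M K K' l1 = 0.
  (* Both halves of every term are expanded by [flag_dual]. The lists [lp] and [lq] are the same for
     all x, so the sum over x can be taken inside, where [key] makes it 0. *)
  transitivity (\sum_(i <- lp) \sum_(j <- lq)
     (flag_elt M (K :: i.1.1) * flag_elt M (rev (K' :: j.1.1))) *~
       (i.1.2 * j.1.2 * \sum_(x <- l | bot x == F) x.1.1.1 *
      (flag_form M (K :: x.1.2) i.2 * flag_form M (K' :: x.2) j.2))).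
    rewrite /downup_sum big_filter big_seq_cond.
    transitivity (\sum_(x <- l | (x \in l) && (bot x == F)) \sum_(i <- lp) \sum_(j <- lq)
       (flag_elt M (K :: i.1.1) * flag_elt M (rev (K' :: j.1.1))) *~
       (i.1.2 * j.1.2 * (x.1.1.1 *
      (flag_form M (K :: x.1.2) i.2 * flag_form M (K' :: x.2) j.2)))).
      apply: eq_bigr => x /andP[/lP[_ pK0 qK0] /eqP xF].
      rewrite -/(bot x) xF in pK0 qK0.
      rewrite (lpE _ _ (@FS_invariant_down _ _ M) _ pK0).
      rewrite (lqE _ _ (@FS_invariant_up _ _ M) _ qK0).
      rewrite mulr_suml mulrz_suml; apply: eq_bigr => i _.
      rewrite mulr_sumr mulrz_suml; apply: eq_bigr => j _.
      rewrite mulrzAl mulrzAr -!mulrzA; congr (_ *~ _).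
      by ring.
    rewrite -big_seq_cond exchange_big; apply: eq_bigr => i _.
    rewrite exchange_big; apply: eq_bigr => j _.
    by rewrite mulr_sumr mulrz_sumr.
  rewrite big1_seq // => i _; rewrite big1_seq // => j /andP[_ /lqP[_ bj]].
  by rewrite key ?mulr0 ?mulr0z.
have lE : downup_sum M K K' l = downup_sum M K K' l2 by rewrite sumE l1_0 add0r.
(* The terms with bottom [F] cancel in S(M) and [x1] is one of them, so a shorter list with the same
   sum remains. *)
rewrite lE; apply: IH.
- rewrite -ltnS; apply: leq_trans ltn; rewrite ltnS size_filter.
  rewrite -(count_predC (fun x => bot x == F) l) -[X in (X < _)%N]add0n.
  rewrite ltn_add2r -has_count; apply/hasP; exists x1 => //; exact/eqP.
- by move=> x; rewrite mem_filter => /andP[_ /lP].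
- by rewrite -lE.
Qed.

End Independence.

(** In the application neither direction has a formula; both are found by choosing lifts to a third
    ring. *)
Lemma rmorphism_of_graph (A B : pzRingType) (R : A -> B -> Prop) :
  (forall a, exists b, R a b) -> (forall b, exists a, R a b) ->
  (forall a b b', R a b -> R a b' -> b = b') ->
  (forall a a' b, R a b -> R a' b -> a = a') ->
  R 1 1 -> (forall a b a' b', R a b -> R a' b' -> R (a - a') (b - b')) ->
  (forall a b a' b', R a b -> R a' b' -> R (a * a') (b * b')) ->
  exists phi : {rmorphism A -> B}, bijective phi.
Proof.
move=> /choice[f fR] /choice[g gR] Rr Rl R1 RB RM.
have fB : zmod_morphism f by move=> x y; apply: Rr (fR _) (RB _ _ _ _ (fR _) (fR _)).
have fM : monoid_morphism f.
  by split=> [|x y]; [apply: Rr (fR _) R1 | apply: Rr (fR _) (RM _ _ _ _ (fR _) (fR _))].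
pose phi := HB.pack_for {rmorphism A -> B} f
  (GRing.isZmodMorphism.Build _ _ f fB) (GRing.isMonoidMorphism.Build _ _ f fM).
exists phi; exists g => [a|b]; first exact: Rl (gR _) (fR a).
exact: Rr (fR _) (gR b).
Qed.

(** * Compression to the cyclic flats *)

Section SchurRepresentation.
Variables (d : Order.disp_t) (E : finOrderType d) (M : matroid E).
Implicit Types (F G H K L N X B : {set E}) (p q : seq {set E}).
Implicit Types (f g h : pathalg M) (u v : ext E) (w : ext_family E).
Implicit Types (b x y : bmod M) (i : basis_index M).

Local Notation comp := Defs.comp.

Definition comp_family F b : ext_family E := [ffun G => comp F G b].

Lemma comp_family_supported F b : fam_supported M F (comp_family F b).
Proof.
by move=> G B; rewrite ffunE; apply: contraNT => nB; rewrite comp0_out.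
Qed.

Lemma comp_family_linear F (a : int) x y :
  comp_family F (a *: x + y) = comp_family F x *~ a + comp_family F y.
Proof.
apply/ffunP => G; apply/ffunP => B; rewrite ffunE comp_linear.
rewrite -[RHS]/(ext_coef B (fam_coef G _)) raddfD raddfMz raddfD raddfMz /=.
by rewrite mulrzz mulrC /fam_coef /ext_coef !ffunE.
Qed.

Lemma bmod_linE (a : int) x y i : (a *: x + y) i = a * x i + y i.
Proof. by rewrite !ffunE. Qed.

(** Only the ends of a path are restricted to cyclic flats: [comp_family] vanishes at other flats
    and [basis_index] omits them. In between, the path may visit any flat. *)
Definition schur_rep_fun f b : bmod M := [ffun i : basis_index M =>
  alg_act (val i).1.1 (comp_family (val i).1.1 b) f (val i).1.2 (val i).2].

Lemma schur_rep_funE f b i : schur_rep_fun f b i =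
  alg_act (val i).1.1 (comp_family (val i).1.1 b) f (val i).1.2 (val i).2.
Proof. exact: ffunE. Qed.

Lemma alg_act_comp_linear F f (a : int) x y G B :
  alg_act F (comp_family F (a *: x + y)) f G B =
  a * alg_act F (comp_family F x) f G B + alg_act F (comp_family F y) f G B.
Proof.
rewrite comp_family_linear -[alg_act F (_ + _) _]/(alg_act_by F f _) raddfD raddfMz /=.
rewrite -[LHS]/(ext_coef B (fam_coef G _)) raddfD raddfMz raddfD raddfMz /=.
by rewrite mulrzz mulrC.
Qed.

Lemma schur_rep_fun_linear f : linear (schur_rep_fun f).
Proof.
move=> a x y; apply/ffunP => i; rewrite schur_rep_funE alg_act_comp_linear.
by rewrite -!schur_rep_funE bmod_linE.
Qed.

HB.instance Definition _ f :=
  GRing.isLinear.Build int (bmod M) (bmod M) _ (schur_rep_fun f)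
    (schur_rep_fun_linear f).

Definition schur_rep f : bend M := linfun (schur_rep_fun f).

Lemma schur_repE f b i :
  schur_rep f b i = alg_act (val i).1.1 (comp_family (val i).1.1 b) f (val i).1.2 (val i).2.
Proof. by rewrite lfunE; apply: schur_rep_funE. Qed.

Lemma schur_rep_ext f (g : bend M) : (forall b i, schur_rep f b i = g b i) ->
  schur_rep f = g.
Proof. by move=> fg; apply/lfunP => b; apply/ffunP => i. Qed.

Definition cyclic_sum : pathalg M := \sum_(K | cyclic_flat M K) path_elt M [:: K].

Lemma cyclic_sum_act F w : alg_act F w cyclic_sum =
  [ffun G => if cyclic_flat M G then w G else 0].
Proof. by rewrite alg_act_idem // => K /andP[]. Qed.

Lemma comp_family_rep F f b : cyclic_flat M F ->
  comp_family F (schur_rep f b) = alg_act F (comp_family F b) (cyclic_sum * f).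
Proof.
move=> cF; rewrite alg_actM cyclic_sum_act; apply/ffunP => G; rewrite !ffunE.
have sA : fam_supported M F (alg_act F (comp_family F b) f).
  by apply/alg_act_supported/comp_family_supported.
apply/ffunP => B; rewrite ffunE; case: insubP => [i|].
  by case/and3P => _ cG _ iE; rewrite schur_repE iE /= cG.
rewrite /= cF /=; case: ifP => [cG /= nB|_ _]; last by rewrite ffunE.
by symmetry; apply/eqP; apply: contraNT nB => /sA.
Qed.

(** The restriction to cyclic flats between the two compressions is the action of [cyclic_sum]. *)
Lemma schur_repM f g : schur_rep (f * cyclic_sum * g) = schur_rep f * schur_rep g.
Proof.
rewrite -(mulrA f); apply: schur_rep_ext => b i; rewrite comp_lfunE !schur_repE.
have /and3P[cF _ _] := valP i.
by rewrite (comp_family_rep _ _ cF) (alg_actM _ _ f).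
Qed.

Lemma compE b i : comp (val i).1.1 (val i).1.2 b (val i).2 = b i.
Proof.
rewrite ffunE.
have -> : ((val i).1.1, (val i).1.2, (val i).2) = val i by case: (val i) => [[]].
by rewrite valK.
Qed.

Lemma comp_familyE i b : comp_family (val i).1.1 b (val i).1.2 (val i).2 = b i.
Proof. by rewrite ffunE compE. Qed.

Lemma schur_rep1 : schur_rep 1 = 1.
Proof.
apply: schur_rep_ext => b i; rewrite schur_repE id_lfunE.
have /and3P[_ /andP[fG _] _] := valP i.
rewrite -[1 : pathalg M]/(\sum_(K | flat M K) path_elt M [:: K]) alg_act_idem //.
by rewrite ffunE fG comp_familyE.
Qed.

Lemma schur_repB f g : schur_rep (f - g) = schur_rep f - schur_rep g.
Proof.
apply: schur_rep_ext => b i; rewrite add_lfunE opp_lfunE !ffunE !schur_repE.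
by rewrite raddfB !ffunE.
Qed.

Lemma schur_rep0 : schur_rep 0 = 0.
Proof. by rewrite -(subrr 0) schur_repB subrr. Qed.

Lemma schur_rep_idem f : schur_rep (cyclic_sum * f * cyclic_sum) = schur_rep f.
Proof.
rewrite -[_ * _ * _]mulr1 schur_repM -[cyclic_sum]mul1r schur_repM.
by rewrite schur_rep1 mulr1 mul1r.
Qed.

Lemma schur_rep_cyclic_sum : schur_rep cyclic_sum = 1.
Proof. by rewrite -[cyclic_sum]mul1r -[_ * _]mulr1 schur_repM schur_rep1 mulr1. Qed.

Lemma schur_rep_trivial f : acts_trivially f -> schur_rep f = 0.
Proof.
move=> f0; apply: schur_rep_ext => b i; rewrite schur_repE zero_lfunE.
have /and3P[cF _ _] := valP i.
by rewrite f0 ?ffunE //; apply: comp_family_supported.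
Qed.

(** A supported family cut down to the cyclic flats is the F-part of some element of [bmod M], so
    the compression records the whole action of e f e. *)
Lemma schur_rep_eq0 f : schur_rep f = 0 ->
  acts_trivially (cyclic_sum * f * cyclic_sum).
Proof.
move=> f0 F w cF sw; rewrite !alg_actM !cyclic_sum_act.
set w' := (X in alg_act F X f).
pose b : bmod M := [ffun i => if (val i).1.1 == F then w (val i).1.2 (val i).2 else 0].
have -> : w' = comp_family F b.
  apply/ffunP => G; rewrite !ffunE; apply/ffunP => B; rewrite ffunE.
  case: insubP => [i /and3P[_ /= -> _] iE|].
    by have iE' : val i = (F, G, B) := iE; rewrite ffunE iE' eqxx.
  rewrite /= cF /=; case: ifP => [cG /= nB|_ _]; last by rewrite ffunE.
  by apply/eqP; apply: contraNT nB => /sw.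
apply/ffunP => G; rewrite !ffunE; case: ifP => // cG.
apply/ffunP => B; rewrite [RHS]ffunE.
have [bB|nB] := boolP (minor_basis M F G B); last first.
  have sA : fam_supported M F (alg_act F (comp_family F b) f).
    by apply/alg_act_supported/comp_family_supported.
  by apply/eqP; apply: contraNT nB => /sA.
have iP : [&& cyclic_flat M F, cyclic_flat M G & minor_basis M F G B] by rewrite cF cG.
pose i : basis_index M := exist _ (F, G, B) iP.
have := schur_repE f b i; rewrite f0 zero_lfunE ffunE /= => <-.
by [].
Qed.

Definition embed N K u : bmod M :=
  [ffun i => if ((val i).1.1 == N) && ((val i).1.2 == K) then u (val i).2 else 0].

Lemma embedE N K u i : embed N K u i =
  if ((val i).1.1 == N) && ((val i).1.2 == K) then u (val i).2 else 0.
Proof. exact: ffunE. Qed.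

Lemma comp_embed N K u F G : cyclic_flat M N -> cyclic_flat M K ->
  supported M N K u ->
  comp F G (embed N K u) = if (F == N) && (G == K) then u else 0.
Proof.
move=> cN cK su; apply/ffunP => B; rewrite ffunE; case: insubP => [i _ iE|].
  by rewrite ffunE iE /=; case: ifP; rewrite ?ffunE.
case: ifP => [/andP[/eqP -> /eqP ->]|]; last by rewrite ffunE.
by rewrite /= cN cK /= => nB; symmetry; apply/eqP; apply: contraNT nB => /su.
Qed.

Lemma embed_is_zmod_morphism N K : zmod_morphism (embed N K).
Proof. by move=> u v; apply/ffunP => i; rewrite !ffunE; case: ifP; rewrite ?subr0. Qed.

HB.instance Definition _ N K :=
  GRing.isZmodMorphism.Build (ext E) (bmod M) (embed N K)
    (embed_is_zmod_morphism N K).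

Definition bmod_coef i b : int := b i.

Lemma bmod_coef_is_zmod_morphism i : zmod_morphism (bmod_coef i).
Proof. by move=> x y; rewrite /bmod_coef !ffunE. Qed.

HB.instance Definition _ i :=
  GRing.isZmodMorphism.Build (bmod M) int (bmod_coef i)
    (bmod_coef_is_zmod_morphism i).

Lemma bmod_sumE (I : Type) (r : seq I) (P : pred I) (f : I -> bmod M) i :
  (\sum_(j <- r | P j) f j) i = \sum_(j <- r | P j) f j i.
Proof. exact: (raddf_sum (bmod_coef i)). Qed.

Lemma embed_sum b :
  b = \sum_(N | cyclic_flat M N) \sum_(K | cyclic_flat M K) embed N K (comp N K b).
Proof.
apply/ffunP => i; have /and3P[cN cK _] := valP i.
rewrite bmod_sumE (bigD1 _ cN) [X in _ = _ + X]big1 ?addr0 => [|N /andP[_ nN]]; last first.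
  rewrite bmod_sumE big1 // => K _; rewrite embedE eq_sym.
  by move/negPf: nN => ->.
rewrite bmod_sumE (bigD1 _ cK) [X in _ = _ + X]big1 ?addr0 => [|K /andP[_ nK]]; last first.
  by rewrite embedE [_ == K]eq_sym (negPf nK) andbF.
by rewrite embedE !eqxx compE.
Qed.

Lemma comp_supported F G b : supported M F G (comp F G b).
Proof. by move=> B; apply: contraNT => nB; rewrite comp0_out. Qed.

Lemma schur_rep_down N K p : cyclic_flat M N -> cyclic_flat M K -> flag M N K p ->
  schur_rep (path_elt M (K :: p)) = mu (embed N K (flag_form M (K :: p))).
Proof.
move=> cN cK pK; have fN : flat M N by case/andP: cN.
have fK : flat M K by case/andP: cK.
have su := flag_form_supported fN fK pK.
apply: schur_rep_ext => b i; rewrite schur_repE (alg_act_down _ _ fN pK).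
have /and3P[cF cG _] := valP i.
have sumE F G : \sum_(H | cyclic_flat M H)
    wedge (comp H G (embed N K (flag_form M (K :: p)))) (comp F H b) =
    if G == K then wedge (flag_form M (K :: p)) (comp F N b) else 0.
  rewrite (bigD1 _ cN) /= big1 => [|H /andP[_ HN]].
    by rewrite comp_embed // eqxx addr0; case: (G == K); rewrite ?wedge0l.
  by rewrite comp_embed // (negPf HN) wedge0l.
rewrite -[RHS]compE muE (comp_star _ _ cF cG) sumE (act_flag _ _ pK).
by rewrite ffunE [comp_family _ _ _]ffunE.
Qed.

Lemma comp_bmon F G i : comp F G (bmon i) =
  if (F == (val i).1.1) && (G == (val i).1.2) then ext_mon (val i).2 else 0.
Proof.
apply/ffunP => B; rewrite ffunE.
have iE : (F, G, B) == val i = [&& F == (val i).1.1, G == (val i).1.2 & B == (val i).2].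
  by case: (val i) => [[F' G'] B']; rewrite -!pair_eqE /= /pair_eq /= andbA.
transitivity (((F, G, B) == val i)%:R : int); last first.
  by rewrite iE andbA; case: ifP => _; rewrite ffunE.
case: insubP => [j _ jE|nP]; first by rewrite ffunE -jE val_eqE.
by case: eqP nP => // ->; rewrite (valP i).
Qed.

Lemma eform_comp F K u x :
  eform u (comp F K x) =
  \sum_(i : basis_index M | ((val i).1.1 == F) && ((val i).1.2 == K)) u (val i).2 * x i.
Proof.
pose o B : option (basis_index M) := insub (F, K, B).
rewrite /eform (bigID (fun B => isSome (o B))) /= addrC big1 => [|B nB]; last first.
  by rewrite ffunE; move: nB; rewrite /o; case: insub => // _; rewrite mulr0.
rewrite add0r (reindex_omap (fun i : basis_index M => (val i).2) o) => [|B]; last first.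
  by rewrite /o; case: insubP => //= i _ ->.
have oE i : isSome (o (val i).2) && (o (val i).2 == Some i) =
    ((val i).1.1 == F) && ((val i).1.2 == K).
  rewrite /o; apply/andP/andP => [[_ /eqP]|[/eqP <- /eqP <-]].
    by case: insubP => // j _ jE [<-]; rewrite jE /= !eqxx.
  have -> : ((val i).1.1, (val i).1.2, (val i).2) = val i by case: (val i) => [[]].
  by rewrite valK eqxx.
apply: eq_big => i; first exact: oE.
by rewrite oE => /andP[/eqP <- /eqP <-]; rewrite compE.
Qed.

Lemma adjointE (f : bend M) x i : adjoint f x i = bform (f (bmon i)) x.
Proof. by rewrite lfunE; apply: ffunE. Qed.

(** A reversed path acts as the adjoint by [act_adj]; [eform_comp] translates between [eform] on one
    component and [bform]. *)
Lemma schur_rep_up N K p : cyclic_flat M N -> cyclic_flat M K -> flag M N K p ->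
  schur_rep (path_elt M (rev (K :: p))) = kappa (embed N K (flag_form M (K :: p))).
Proof.
move=> cN cK pK; have fN : flat M N by case/andP: cN.
have fK : flat M K by case/andP: cK.
apply: schur_rep_ext => x i; rewrite schur_repE (alg_act_up _ _ fN pK).
rewrite /kappa -schur_rep_down // adjointE /bform.
have /and3P[cF cG bB] := valP i.
have jE (j : basis_index M) : schur_rep (path_elt M (K :: p)) (bmon i) j =
    if ((val j).1.1 == (val i).1.1) && ((val j).1.2 == K) then
      (if N == (val i).1.2 then act M (val i).1.1 (K :: p) (ext_mon (val i).2) (val j).2
       else 0) else 0.
  rewrite schur_repE (alg_act_down _ _ fN pK) !ffunE comp_bmon.
  case: ((val j).1.2 == K); rewrite ?andbF ?ffunE // andbT.
  case: eqP => [->|_]; last by rewrite andFb act0 ffunE.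
  by rewrite andTb; case: (N == _) => //; rewrite act0 ffunE.
under eq_bigr do rewrite jE.
rewrite !ffunE eq_sym; case: eqP => [NG|_]; last first.
  by rewrite ffunE big1 // => j _; rewrite if_same mul0r.
transitivity (eform (act M (val i).1.1 (K :: p) (ext_mon (val i).2))
   (comp (val i).1.1 K x)).
  have sx : supported M (val i).1.1 K (comp (val i).1.1 K x).
    by move=> B; apply: comp_supported.
  have su : supported M (val i).1.1 (last set0 (K :: p)) (ext_mon (val i).2).
    by rewrite (flag_last pK) NG; apply: supported_mon.
  by rewrite (act_adj (flag_path fK pK) su sx) eformC eform_monr.
rewrite eform_comp big_mkcond; apply: eq_bigr => j _.
by case: ifP => _; rewrite ?mul0r.
Qed.

End SchurRepresentation.

(** * Two-sided products in a ring *)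

Lemma mulr_midD (A : pzRingType) (a b x y : A) : a * (x + y) * b = a * x * b + a * y * b.
Proof. by rewrite mulrDr mulrDl. Qed.

Lemma mulr_midMz (A : pzRingType) (a b x : A) (c : int) :
  a * (x *~ c) * b = (a * x * b) *~ c.
Proof. by rewrite mulrzAr mulrzAl. Qed.

Lemma mulr_absorb (A : pzRingType) (a n c : A) : a = a * n -> n * c = n -> a * c = a.
Proof. by move=> aE nE; rewrite aE -mulrA nE. Qed.

Lemma mulr_mid_sum (A : pzRingType) (T : finType) (P : pred T) (a : T -> A) (z : A) :
  (\sum_(i | P i) a i) * z * (\sum_(i | P i) a i) =
  \sum_(i | P i) \sum_(j | P j) a i * z * a j.
Proof. by rewrite !mulr_suml; apply: eq_bigr => i _; rewrite mulr_sumr. Qed.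

Lemma mulr_mid_absorb (A : pzRingType) (a b c x : A) : a * c = a -> c * b = b ->
  a * (c * x * c) * b = a * x * b.
Proof. by move=> ac cb; rewrite !mulrA ac -(mulrA _ c b) cb. Qed.

(** * Image and kernel of the representation *)

Section MainTheorem.
Variables (d : Order.disp_t) (E : finOrderType d) (M : matroid E).
Implicit Types (F G H K L N X B : {set E}) (p q : seq {set E}).
Implicit Types (f g h : pathalg M) (u v : ext E) (x y : bmod M).

Local Notation comp := Defs.comp.
Local Notation J := (ideal_gen (@flag_rel E M)).
Local Notation I := (ideal_gen (@join_rel E M)).

Definition flag_pi f : flag_alg M := quot_pi J f.
Local Notation pi := flag_pi.

Lemma flag_pi_is_zmod_morphism : zmod_morphism flag_pi.
Proof. exact: (@quot_pi_zmod_morphism _ J). Qed.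

Lemma flag_pi_is_monoid_morphism : monoid_morphism flag_pi.
Proof. exact: (@quot_pi_monoid_morphism _ J). Qed.

HB.instance Definition _ :=
  GRing.isZmodMorphism.Build (pathalg M) (flag_alg M) flag_pi
    flag_pi_is_zmod_morphism.
HB.instance Definition _ :=
  GRing.isMonoidMorphism.Build (pathalg M) (flag_alg M) flag_pi
    flag_pi_is_monoid_morphism.

Lemma flag_eltE p : flag_elt M p = pi (path_elt M p).
Proof. by []. Qed.

Lemma flag_piM f g : pi (f * g) = pi f * pi g.
Proof. exact: (rmorphM flag_pi). Qed.

Lemma flag_piP f g : pi f = pi g <-> J (f - g).
Proof. exact: quot_piP. Qed.

Local Notation e := (cyclic_idem M).

Lemma flag_pi_surj (z : flag_alg M) : exists f, pi f = z.
Proof. by rewrite -[z](@quot_piK _ J); eexists. Qed.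

Lemma pi_cyclic_sum : pi (cyclic_sum M) = e.
Proof. exact: raddf_sum. Qed.

Lemma pi_cyclic_sumM f : pi (cyclic_sum M * f * cyclic_sum M) = e * pi f * e.
Proof. by rewrite rmorphM /= rmorphM /= pi_cyclic_sum. Qed.

Lemma schur_rep_eq_pi f g : pi f = pi g -> schur_rep f = schur_rep g.
Proof.
move/flag_piP/flag_rel_acts_trivially/schur_rep_trivial => fg.
by apply/eqP; rewrite -subr_eq0 -schur_repB fg.
Qed.

Lemma schur_rep_join_ideal f : I (pi f) -> schur_rep f = 0.
Proof. by move/join_rel_acts_trivially/quot_trivialP/schur_rep_trivial. Qed.

Lemma downup_corner K K' f : flat M K -> flat M K' ->
  downup K K' (flag_elt M [:: K] * pi f * flag_elt M [:: K']).
Proof.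
move=> fK fK'; elim/pathalg_ind: f => [|f g IHf IHg|c p].
- have -> : pi 0 = 0 by exact: rmorph0.
  by rewrite mulr0 mul0r; apply: downup0.
- have -> : pi (f + g) = pi f + pi g by exact: rmorphD.
  rewrite (@mulr_midD (flag_alg M)).
  exact: (downupD IHf IHg).
have -> : pi (c *: << p >>) = pi << p >> *~ c.
  by rewrite -[c]intz scaler_int raddfMz intz.
rewrite (@mulr_midMz (flag_alg M)).
apply: additive_pred_Mz; [exact: downup0 | by move=> *; apply: DU_sub |].
have -> : flag_elt M [:: K] * pi << p >> * flag_elt M [:: K'] =
    pi (path_elt M [:: K] * << p >> * path_elt M [:: K']).
  by rewrite 2!flag_piM -!flag_eltE.
have [kp kpE kE] := flat_path_elt fK; have [kp' kpE' kE'] := flat_path_elt fK'.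
rewrite kE kE' pathalg_mulUU /path_cat kpE /=.
case: eqP => [KE|_]; last by rewrite mul0r raddf0; exact: downup0.
have -> : K :: behead p = p by rewrite KE; case: (p) => [[]].
rewrite path_eltE pathalg_mulUU /path_cat kpE' /=.
case: eqP => [KE'|_]; last by rewrite raddf0; exact: downup0.
rewrite cats0; have pE : K :: behead p = p by rewrite KE; case: (p) => [[]].
rewrite -KE' -pE; apply: downup_path; rewrite pE; exact: valP.
Qed.

Definition in_schur_rep (phi : bend M) := exists f, phi = schur_rep f.

Lemma in_schur_repB phi psi : in_schur_rep phi -> in_schur_rep psi ->
  in_schur_rep (phi - psi).
Proof. by move=> [f ->] [g ->]; exists (f - g); rewrite schur_repB. Qed.

Lemma in_schur_repM phi psi : in_schur_rep phi -> in_schur_rep psi ->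
  in_schur_rep (phi * psi).
Proof. by move=> [f ->] [g ->]; exists (f * cyclic_sum M * g); rewrite schur_repM. Qed.

Lemma in_schur_rep0 : in_schur_rep 0.
Proof. by exists 0; rewrite schur_rep0. Qed.

Lemma compB F G x y : comp F G (x - y) = comp F G x - comp F G y.
Proof.
apply/ffunP => B; rewrite addrC -scaleN1r comp_linear mulN1r addrC.
by rewrite [RHS]ffunE [X in _ = _ + X]ffunE.
Qed.

Lemma mu_is_zmod_morphism : zmod_morphism (@mu d E M).
Proof.
move=> x y; apply/lfunP => b; apply/ffunP => i; have /and3P[cF cG _] := valP i.
rewrite add_lfunE opp_lfunE [RHS]ffunE [X in _ = _ + X]ffunE -!compE !muE.
rewrite (comp_star _ _ cF cG) (comp_star x _ cF cG) (comp_star y _ cF cG).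
rewrite !ext_sumE -sumrB; apply: eq_bigr => H _.
by rewrite compB wedgeBl ffunE [X in _ + X]ffunE.
Qed.

HB.instance Definition _ :=
  GRing.isZmodMorphism.Build (bmod M) (bend M) (@mu d E M) mu_is_zmod_morphism.

Lemma kappa_is_zmod_morphism : zmod_morphism (@kappa d E M).
Proof.
move=> x y; apply/lfunP => b; apply/ffunP => i.
rewrite add_lfunE opp_lfunE [RHS]ffunE [X in _ = _ + X]ffunE /kappa !adjointE.
rewrite raddfB /bform -sumrB; apply: eq_bigr => j _.
by rewrite -mulrBl; congr (_ * _); rewrite add_lfunE opp_lfunE !ffunE.
Qed.

HB.instance Definition _ :=
  GRing.isZmodMorphism.Build (bmod M) (bend M) (@kappa d E M) kappa_is_zmod_morphism.

(** Stated for an additive [T] so as to treat [mu] and [kappa] together; [flag_span] reduces each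
    component to flag forms. *)
Lemma checkU_in_schur_rep (T : {additive bmod M -> bend M}) :
  (forall N K p, cyclic_flat M N -> cyclic_flat M K -> flag M N K p ->
    in_schur_rep (T (embed M N K (flag_form M (K :: p))))) ->
  forall x, in_checkU x -> in_schur_rep (T x).
Proof.
move=> Tf x xU; rewrite [x]embed_sum raddf_sum.
apply: additive_pred_sum; [exact: in_schur_rep0|exact: in_schur_repB|move=> N cN].
rewrite raddf_sum.
apply: additive_pred_sum; [exact: in_schur_rep0|exact: in_schur_repB|move=> K cK].
have sx : supported M N K (comp N K x) by move=> B; apply: comp_supported.
have [NK|nNK] := boolP (N \subset K); last first.
  have -> : comp N K x = 0.
    apply/ffunP => B; rewrite [RHS]ffunE; apply/eqP; apply: contraNT nNK.
    by move/sx/minor_basis_sub.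
  by rewrite !raddf0; apply: in_schur_rep0.
have fN : flat M N by case/andP: cN.
have fK : flat M K by case/andP: cK.
apply: (flag_span fN fK NK sx (xU _ _ cN cK NK)
  (P := fun u => in_schur_rep (T (embed M N K u)))) => [|u v|p pK].
- by rewrite !raddf0; apply: in_schur_rep0.
- by rewrite !raddfB; apply: in_schur_repB.
- exact: Tf.
Qed.

Lemma schur_gen_in_schur_rep phi : subring_mem (@schur_gen d E M) phi -> in_schur_rep phi.
Proof.
elim=> {phi} [phi [x xU phiE]| |x y _ xP _ yP|x y _ xP _ yP].
- case: phiE => ->; apply: checkU_in_schur_rep xU => N K p cN cK pK.
    by exists (path_elt M (K :: p)); rewrite (schur_rep_down cN cK pK).
  by exists (path_elt M (rev (K :: p))); rewrite (schur_rep_up cN cK pK).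
- by exists 1; rewrite schur_rep1.
- exact: in_schur_repB.
- exact: in_schur_repM.
Qed.

Lemma checkU_flag_form N K p : cyclic_flat M N -> cyclic_flat M K ->
  flag M N K p -> in_checkU (embed M N K (flag_form M (K :: p))).
Proof.
move=> cN cK pK F G cF cG FG.
have fN : flat M N by case/andP: cN.
have fK : flat M K by case/andP: cK.
rewrite (comp_embed _ _ cN cK (flag_form_supported fN fK pK)).
case: andP => [[/eqP -> /eqP ->]|_]; first exact: flag_form_wedge0.
exact: wedge0r.
Qed.

Lemma flag_elt_idem N : cyclic_flat M N ->
  flag_elt M [:: N] * e = flag_elt M [:: N].
Proof.
move=> cN; have fN : flat M N by case/andP: cN.
rewrite /cyclic_idem mulr_sumr (bigD1 N) //= flag_elt1M // eqxx.
rewrite big1 ?addr0 // => L /andP[/andP[fL _] LN].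
by rewrite flag_elt1M // eq_sym (negPf LN).
Qed.

Lemma idem_flag_elt N : cyclic_flat M N ->
  e * flag_elt M [:: N] = flag_elt M [:: N].
Proof.
move=> cN; have fN : flat M N by case/andP: cN.
rewrite /cyclic_idem mulr_suml (bigD1 N) //= flag_elt1M // eqxx.
rewrite big1 ?addr0 // => L /andP[/andP[fL _] LN].
by rewrite flag_elt1M // (negPf LN).
Qed.

(** Since the bottom is cyclic, e can be inserted there without changing the path. Then [schur_repM]
    applies and exhibits the image as some [mu] times some [kappa]. *)
Lemma downup_schur_gen K K' z f : cyclic_flat M K -> cyclic_flat M K' ->
  downup K K' z -> pi f = z -> subring_mem (@schur_gen d E M) (schur_rep f).
Proof.
move=> cK cK' zP; elim: zP f => {z} [z Iz|x y _ IHx _ IHy|N p q cN pK qK] f fz.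
- rewrite schur_rep_join_ideal ?fz // -(subrr 1).
  by apply: Sub_B; apply: Sub_1.
- have [g gx] := flag_pi_surj x; have [h hy] := flag_pi_surj y.
  rewrite (@schur_rep_eq_pi f (g - h)); last first.
    by have -> : pi (g - h) = pi g - pi h; [exact: raddfB | rewrite fz gx hy].
  by rewrite schur_repB; apply: Sub_B; [apply: IHx | apply: IHy].
have fN : flat M N by case/andP: cN.
pose g := path_elt M (K :: p) * cyclic_sum M * path_elt M (rev (K' :: q)).
have gz : pi g = pi f.
  rewrite fz /g 2!flag_piM pi_cyclic_sum -!flag_eltE.
  by rewrite (mulr_absorb (flag_elt_mul1 pK) (flag_elt_idem cN)).
rewrite -(schur_rep_eq_pi gz) schur_repM.
rewrite (schur_rep_down cN cK pK) (schur_rep_up cN cK' qK).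
apply: Sub_M; apply: Sub_in.
  by exists (embed M N K (flag_form M (K :: p))); [exact: checkU_flag_form|left].
by exists (embed M N K' (flag_form M (K' :: q))); [exact: checkU_flag_form|right].
Qed.

Lemma schur_rep_is_zmod_morphism : zmod_morphism (@schur_rep d E M).
Proof. exact: schur_repB. Qed.

HB.instance Definition _ :=
  GRing.isZmodMorphism.Build (pathalg M) (bend M) (@schur_rep d E M)
    schur_rep_is_zmod_morphism.

Lemma pi_mid K K' f : pi (path_elt M [:: K] * f * path_elt M [:: K']) =
  flag_elt M [:: K] * pi f * flag_elt M [:: K'].
Proof. by rewrite 2!flag_piM -!flag_eltE. Qed.

Lemma schur_rep_in_subring f : subring_mem (@schur_gen d E M) (schur_rep f).
Proof.
have P0 : subring_mem (@schur_gen d E M) 0.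
  by rewrite -(subrr 1); apply: Sub_B; apply: Sub_1.
rewrite -schur_rep_idem /cyclic_sum mulr_mid_sum raddf_sum.
apply: additive_pred_sum => // [x y|K cK]; first exact: Sub_B.
rewrite raddf_sum; apply: additive_pred_sum => // [x y|K' cK']; first exact: Sub_B.
have fK : flat M K by case/andP: cK.
have fK' : flat M K' by case/andP: cK'.
exact: (downup_schur_gen cK cK' (downup_corner f fK fK') (pi_mid K K' f)).
Qed.

Lemma corner_decomposition (z : flag_alg M) :
  e * z * e = \sum_(K | cyclic_flat M K) \sum_(K' | cyclic_flat M K')
    flag_elt M [:: K] * z * flag_elt M [:: K'].
Proof. exact: mulr_mid_sum. Qed.

(** Modulo I each block (K) f (K') is a sum of down-up paths with cyclic bottoms. The block acts as
    zero and so does I, hence also the sum, which vanishes by [downup_independent]. *)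
Lemma schur_rep_ker f : schur_rep f = 0 -> I (e * pi f * e).
Proof.
move=> f0; rewrite corner_decomposition.
apply: additive_pred_sum => [|x y|K cK]; [exact: ideal_mem0|exact: ideal_memB|].
apply: additive_pred_sum => [|x y|K' cK']; [exact: ideal_mem0|exact: ideal_memB|].
have fK : flat M K by case/andP: cK.
have fK' : flat M K' by case/andP: cK'.
have [l lP lI] := downup_sumP (downup_corner f fK fK').
set z := _ * _ * _ in lI *.
have [h hE h0] := join_rel_acts_trivially lI.
(* A lift of [z] with [cyclic_sum] on both sides of [f], the form in which [schur_rep_eq0] gives
   trivial action. *)
pose g := path_elt M [:: K] * (cyclic_sum M * f * cyclic_sum M) * path_elt M [:: K'].
have gz : pi g = z.
  rewrite pi_mid pi_cyclic_sumM.
  exact: (mulr_mid_absorb _ (flag_elt_idem cK) (idem_flag_elt cK')).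
have g0 : acts_trivially g.
  by apply/acts_triviallyMr/acts_triviallyMl/schur_rep_eq0.
have triv : quot_trivial (downup_sum M K K' l).
  exists (g - h); last first.
    by move=> F w cF sw; rewrite raddfB /= g0 // h0 // subrr.
  rewrite -[LHS]/(pi (g - h)); have -> : pi (g - h) = pi g - pi h by exact: raddfB.
  by rewrite gz [pi h]hE; exact: subKr.
by move: lI; rewrite (downup_independent lP triv) subr0.
Qed.

End MainTheorem.

Theorem theorem11p4 (d : Order.disp_t) (E : finOrderType d) (M : matroid E) :
  exists phi : {rmorphism matroidal_schur M -> cyclic_flag_quot M},
    bijective phi.
Proof.
pose ee := cyclic_idemP M.
pose Q := quot_pi (corner_ideal ee (ideal_gen (@join_rel E M))).
pose R (s : matroidal_schur M) (c : cyclic_flag_quot M) := exists f (x : cyclic_corner M),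
  [/\ Q x = c, corner_val x = flag_pi f & subring_val s = schur_rep f].
have piB f g : flag_pi (f - g) = flag_pi f - flag_pi g :> flag_alg M by exact: raddfB.
apply: (@rmorphism_of_graph _ _ R).
- move=> s; have [f sf] := schur_gen_in_schur_rep (elimT (asboolP _) (valP s)).
  pose x : cyclic_corner M := Corner (corner_in ee (flag_pi f)).
  exists (Q x), (cyclic_sum M * f * cyclic_sum M), x; split; first by [].
    exact/esym/pi_cyclic_sumM.
  by rewrite schur_rep_idem.
- move=> c; rewrite -[c](@quot_piK _ (corner_ideal ee _)); set x := repr _.
  have [f fx] := flag_pi_surj (corner_val x).
  exists (SubringGen (introT (asboolP _) (schur_rep_in_subring f))), f, x.
  by split.
- move=> s c c' [f [x [<- xf sf]]] [f' [x' [<- xf' sf']]].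
  have v : corner_val (x - x') = flag_pi (f - f') by rewrite piB -xf -xf'.
  have vE : cyclic_idem M * flag_pi (f - f') * cyclic_idem M = flag_pi (f - f').
    by rewrite -v; apply/eqP; apply: (valP (x - x')).
  (* An element of the corner that lies in I is its own witness for the ideal eIe. *)
  apply/quot_piP; exists (flag_pi (f - f')); last by rewrite vE.
  rewrite -vE; apply: schur_rep_ker.
  by rewrite schur_repB -sf -sf' subrr.
- move=> s s' c [f [x [xc xf sf]]] [f' [x' [xc' xf' sf']]].
  have v : corner_val (x - x') = flag_pi (f - f') by rewrite piB -xf -xf'.
  have /quot_piP[i Ii iE] : Q x = Q x' by rewrite xc xc'.
  apply: val_inj; rewrite /= sf sf'; apply/eqP; rewrite -subr_eq0 -schur_repB.
  rewrite schur_rep_join_ideal // -v iE.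
  exact/ideal_memMr/ideal_memMl.
(* The unit of the corner is e, which [cyclic_sum] lifts. *)
- exists (cyclic_sum M), 1; split; first exact: rmorph1.
    exact/esym/pi_cyclic_sum.
  by rewrite schur_rep_cyclic_sum.
- move=> s c s' c' [f [x [xc xf sf]]] [f' [x' [xc' xf' sf']]].
  exists (f - f'), (x - x'); split.
  + by rewrite -xc -xc'; exact: raddfB.
  + by rewrite piB -xf -xf'.
  + by rewrite schur_repB -sf -sf'.
- move=> s c s' c' [f [x [xc xf sf]]] [f' [x' [xc' xf' sf']]].
  (* Elements of the corner absorb e, so the extra factor does not affect [x * x']. *)
  exists (f * cyclic_sum M * f'), (x * x'); split.
  + by rewrite -xc -xc'; exact: rmorphM.
  + rewrite 2!flag_piM pi_cyclic_sum -xf -xf'.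
    by have /= -> := corner_er ee (valP x).
  + by rewrite schur_repM -sf -sf'.
Qed.
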